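(* For general Kundt metrics in dimension $n=4$, let $$I_1=\frac{(W_1)_v^2h_{22}-2(W_1)_v(W_2)_vh_{12}+(W_2)_v^2h_{11}}{h_{11}h_{22}-h_{12}^2},$$ $A=(W_1)_vh_{22}-(W_2)_vh_{12}$, $B=(W_1)_vh_{12}-(W_2)_vh_{11}$, and $T=T_0/T_1$ with $$T_0=A^3(h_{11})_{x^1}-\left((h_{11})_{x^2}+2(h_{12})_{x^1}\right)A^2B+\left((h_{22})_{x^1}+2(h_{12})_{x^2}\right)AB^2-B^3(h_{22})_{x^2}-2(h_{11}h_{22}-h_{12}^2)\left(A^2(W_1)_{x^1v}+B^2(W_2)_{x^2v}-AB\left((W_1)_{x^2v}+(W_2)_{x^1v}\right)\right),$$ $$T_1=2(h_{11}h_{22}-h_{12}^2)\left(A(W_1)_{vv}-B(W_2)_{vv}\right).$$ The derivations $$\nabla_1=\frac{(W_1)_v^2h_{22}-2(W_1)_v(W_2)_vh_{12}+(W_2)_v^2h_{11}}{A(W_1)_{vv}-B(W_2)_{vv}}\,\mathcal{D}_v,$$ $$\nabla_2=\frac{(W_2)_{vv}\mathcal{D}_{x^1}-(W_1)_{vv}\mathcal{D}_{x^2}+\left((W_1)_{x^2v}-(W_2)_{x^1v}\right)\mathcal{D}_v}{(W_1)_v(W_2)_{vv}-(W_2)_v(W_1)_{vv}},$$ $$\nabla_3=\frac{A\,\mathcal{D}_{x^1}-B\,\mathcal{D}_{x^2}+T\,\mathcal{D}_v}{h_{11}h_{22}-h_{12}^2},\qquad \nabla_4=g^{-1}\hat dI_1$$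 are invariant with respect to $\mathcal{G}$, and they are independent on a Zariski open subset of $\mathcal{E}^2$.
   Context: Four-dimensional Kundt metrics in adapted coordinates $(u,x^1,x^2,v)$ are $g=du\,(dv+H\,du+W_1\,dx^1+W_2\,dx^2)+\sum_{i,j=1}^2h_{ij}\,dx^i\,dx^j$ with $H,W_i$ functions of $(u,x,v)$, $h_{ij}=h_{ji}$ functions of $(u,x)$, $(h_{ij})$ positive definite. Let $\pi$ be the trivial bundle over $\mathbb{R}^4(u,x^1,x^2,v)$ with fiber coordinates $H,W_1,W_2,h_{11},h_{12},h_{22}$ ($(h_{ij})$ positive definite). $\mathcal{E}^0=J^0\pi$, and for $k\ge1$ $\mathcal{E}^k\subset J^k\pi$ is given by $(h_{ij})_v=0$ and all their total derivatives of order $\le k$; $\mathcal{E}^\infty$ is the infinite prolongation. $\mathcal{G}$ is the Lie pseudogroup of local diffeomorphisms $(u,x^i,v)\mapsto(C(u),A^i(u,x),v/C'(u)+B(u,x))$ with $\det[A^i_{x^j}]\neq0$, $C'\ne0$ (the functions $A^i,B$ here are unrelated to $A,B$ in the claim); it acts on Kundt metrics of the form $g=du\,(dv+H\,du+W_1\,dx^1+W_2\,dx^2)+\sum_{i,j=1}^2h_{ij}\,dx^i\,dx^j$, hence on $J^0\pi$ (so that $g$, viewed as a horizontal symmetric 2-form on $\pi$, is invariant), and the action prolongs to jets preserving $\mathcal{E}^k$. Subscripts denote jet variables; $\mathcal{D}_u,\mathcal{D}_{x^i},\mathcal{D}_v$ are the total derivatives; the horizontal differential is $\hat df=\mathcal{D}_u(f)du+\mathcal{D}_{x^i}(f)dx^i+\mathcal{D}_v(f)dv$;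 for a horizontal 1-form $\omega$, $g^{-1}\omega$ is the horizontal vector field $X$ with $g(X,\cdot)=\omega$. An invariant derivation is a horizontal vector field (combination of total derivatives with coefficients functions on some $\mathcal{E}^r$) invariant under the prolonged action of $\mathcal{G}$. ''Zariski open'' means nonempty Zariski open (in the fibers over $J^0\pi$). *)

(* Defs.v *)
From mathcomp Require Import all_boot all_order all_algebra.
From mathcomp Require Import all_classical all_reals all_analysis.
Set Implicit Arguments.
Unset Strict Implicit.
Unset Printing Implicit Defensive.
Import Order.TTheory GRing.Theory Num.Theory.
Import numFieldNormedType.Exports.
Local Open Scope classical_set_scope.
Local Open Scope ring_scope.

(* Positions of the base coordinates (u, x^1, x^2, v). *)
Definition iu : 'I_4 := @Ordinal 4 0 isT.
Definition ix1 : 'I_4 := @Ordinal 4 1 isT.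
Definition ix2 : 'I_4 := @Ordinal 4 2 isT.
Definition iv : 'I_4 := @Ordinal 4 3 isT.
Definition ix (j : 'I_2) : 'I_4 := if j == 0 then ix1 else ix2.

(* Positions of the fiber coordinates (H, W_1, W_2, h_11, h_12, h_22). *)
Definition cH : 'I_6 := @Ordinal 6 0 isT.
Definition cW1 : 'I_6 := @Ordinal 6 1 isT.
Definition cW2 : 'I_6 := @Ordinal 6 2 isT.
Definition ch11 : 'I_6 := @Ordinal 6 3 isT.
Definition ch12 : 'I_6 := @Ordinal 6 4 isT.
Definition ch22 : 'I_6 := @Ordinal 6 5 isT.
Definition is_h : pred 'I_6 := fun a => a \in [:: ch11; ch12; ch22].

(* In finite dimension [Cn_on n N f] says that f is of class C^n on N: the
   derivatives along all constant directions are taken recursively. *)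
Fixpoint Cn_on (R : realType) (V W : normedModType R) (n : nat) (N : set V)
    (f : V -> W) : Prop :=
  if n is n'.+1 then
    (forall x, N x -> differentiable f x) /\
    (forall w : V, Cn_on n' N (fun x => 'D_w f x))
  else forall x, N x -> {for x, continuous f}.

Definition smooth_on (R : realType) (V W : normedModType R) (N : set V)
    (f : V -> W) : Prop :=
  forall n, Cn_on n N f.

Definition smooth_at (R : realType) (V W : normedModType R) (x : V)
    (f : V -> W) : Prop :=
  exists N : set V, [/\ open N, N x & smooth_on N f].

Definition partial (R : realType) (i : 'I_4) (f : 'rV[R]_4 -> R) :
    'rV[R]_4 -> R :=
  fun q => 'D_(delta_mx 0 i) f q.

(* Multi-indices of length at most k. *)
Definition mi (k : nat) : finType :=
  {s : {ffun 'I_4 -> 'I_k.+1} | (\sum_i s i <= k)%N}.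

Definition mi_at k (j : 'I_#|mi k|) : mi k := enum_val j.

Definition multi_partial (R : realType) (k : nat) (s : mi k)
    (f : 'rV[R]_4 -> R) : 'rV[R]_4 -> R :=
  foldr (fun i g => iter (val s i) (partial i) g) f (enum 'I_4).

Section Jets.
Variable R : realType.

(* The coordinate space of J^k pi: the base point and the jet coordinates
   u^a_s, a : 'I_6, |s| <= k. Positivity of (h_ij) is imposed in [kundt_jet]. *)
Definition jet (k : nat) : Type := ('rV[R]_4 * 'M[R]_(6, #|mi k|))%type.

(* The jet coordinate u^a_m; multi-indices m longer than k give 0. *)
Definition jcoord k (t : jet k) (a : 'I_6) (m : 'I_4 -> nat) : R :=
  if [pick s : mi k | [forall i, (val s i == m i :> nat)]] is Some s
  then t.2 a (enum_rank s) else 0.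

(* The coordinate of the fiber variable a differentiated along the word w,
   e.g. [jd t cW1 [:: ix2; iv]] is (W_1)_{x^2 v}. *)
Definition jd k (t : jet k) (a : 'I_6) (w : seq 'I_4) : R :=
  jcoord t a (fun i => count_mem i w).

(* The projection J^m pi -> J^k pi, used for k <= m only. *)
Definition jproj k m (t : jet m) : jet k :=
  (t.1, \matrix_(a, j) jcoord t a (fun l => val (mi_at j) l)).

Definition jfib k (t : jet k) : 'rV[R]_6 := \row_a jd t a [::].

Definition jet_of k (s : 'rV[R]_4 -> 'rV[R]_6) (p : 'rV[R]_4) : jet k :=
  (p, \matrix_(a, j) multi_partial (mi_at j) (fun q => s q 0 a) p).

Definition hmx (y : 'rV[R]_6) : 'M[R]_2 :=
  \matrix_(i, j)
    y 0 (if i == j then (if i == 0 then ch11 else ch22) else ch12).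

Definition h_posdef (y : 'rV[R]_6) : Prop :=
  forall x : 'rV[R]_2, x != 0 -> 0 < (x *m hmx y *m x^T) 0 0.

(* A product of 1-forms in a metric is the symmetrized tensor product. *)
Definition symprod (a b : 'rV[R]_4) : 'M[R]_4 :=
  2%:R^-1 *: (a^T *m b + b^T *m a).

Definition dform (i : 'I_4) : 'rV[R]_4 := delta_mx 0 i.

Definition kundt_metric (y : 'rV[R]_6) : 'M[R]_4 :=
  symprod (dform iu)
    (dform iv + y 0 cH *: dform iu
     + y 0 cW1 *: dform ix1 + y 0 cW2 *: dform ix2)
  + \sum_(i < 2) \sum_(j < 2) hmx y i j *: symprod (dform (ix i)) (dform (ix j)).

(* A smooth Kundt metric, given by its coefficient functions, on the open
   set N. *)
Definition kundt_on (N : set 'rV[R]_4) (s : 'rV[R]_4 -> 'rV[R]_6) : Prop :=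
  [/\ open N, smooth_on N s, forall q, N q -> h_posdef (s q)
    & forall q a, N q -> is_h a -> partial iv (fun q' => s q' 0 a) q = 0].

(* The equation E^k in J^k pi. *)
Definition kundt_jet k : set (jet k) :=
  [set t | h_posdef (jfib t) /\
    forall (a : 'I_6) (s : mi k), is_h a -> (0 < val s iv)%N ->
      t.2 a (enum_rank s) = 0].

Definition local_diffeo (U V : set 'rV[R]_4) (phi psi : 'rV[R]_4 -> 'rV[R]_4) :
    Prop :=
  [/\ open U /\ open V, smooth_on U phi /\ smooth_on V psi,
      forall q, U q -> V (phi q) /\ psi (phi q) = q
    & forall q, V q -> U (psi q) /\ phi (psi q) = q].

(* The local diffeomorphism phi with domain U belongs to the pseudogroup of
   the maps (u, x, v) |-> (C(u), A^i(u, x), v / C'(u) + B(u, x)). *)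
Definition in_pseudogroup (U : set 'rV[R]_4) (phi : 'rV[R]_4 -> 'rV[R]_4) :
    Prop :=
  (exists V psi, local_diffeo U V phi psi) /\
  exists (C : R -> R) (A : 'I_2 -> R -> R -> R -> R) (B : R -> R -> R -> R),
    let Cq (q : 'rV[R]_4) := C (q 0 iu) in
    let Aq i (q : 'rV[R]_4) := A i (q 0 iu) (q 0 ix1) (q 0 ix2) in
    let Bq (q : 'rV[R]_4) := B (q 0 iu) (q 0 ix1) (q 0 ix2) in
    [/\ smooth_on U Cq, forall i, smooth_on U (Aq i), smooth_on U Bq
      & forall q, U q ->
        [/\ derive1 C (q 0 iu) != 0,
            \det (\matrix_(i < 2, j < 2) partial (ix j) (Aq i) q) != 0,
            phi q 0 iu = Cq q, forall i, phi q 0 (ix i) = Aq i q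
          & phi q 0 iv = q 0 iv / derive1 C (q 0 iu) + Bq q]].

(* The graph of the prolonged action phi^(k) on E^k. With the convention that
   'J phi q acts on row vectors from the right, the displayed equation says
   that g = phi^* g' near p, i.e. that phi takes the metric g given by s to
   the metric g' given by s'; then phi^(k) takes the k-jet of s at p to the
   k-jet of s' at phi p. *)
Definition prolonged (U : set 'rV[R]_4) (phi : 'rV[R]_4 -> 'rV[R]_4) k
    (t t' : jet k) : Prop :=
  exists (p : 'rV[R]_4) (N N' : set 'rV[R]_4) (s s' : 'rV[R]_4 -> 'rV[R]_6),
    [/\ U p /\ N p /\ N' (phi p), kundt_on N s /\ kundt_on N' s',
        \forall q \near p,
          kundt_metric (s q)
          = 'J phi q *m kundt_metric (s' (phi q)) *m ('J phi q)^T,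
        t = jet_of k s p
      & t' = jet_of k s' (phi p)].

(* The value at t of the total derivative D_i, truncated to J^k pi: the vector
   d/dx^i + \sum_(a, |s| <= k) u^a_(s + 1_i) d/du^a_s. *)
Definition total_vector k (t : jet k.+1) (i : 'I_4) : jet k :=
  (delta_mx 0 i,
   \matrix_(a, j) jcoord t a (fun l => val (mi_at j) l + (l == i))%N).

Definition total_deriv k (i : 'I_4) (f : jet k -> R) : jet k.+1 -> R :=
  fun t => 'D_(total_vector t i) f (jproj k t).

(* The horizontal vector field \sum_i hcoef_i D_i, with coefficients of order
   r, defined on the subset hdom of E^r. *)
Record hfield (r : nat) := HField {
  hdom : set (jet r);
  hcoef : jet r -> 'rV[R]_4 }.

Definition happly r (X : hfield r) k (f : jet k -> R) (t : jet k.+1) : R :=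
  \sum_i hcoef X (jproj r t) 0 i * total_deriv i f t.

(* Invariance: the domain of X is preserved by the prolonged action and
   X (f o phi^(k)) = (X f) o phi^(k+1) for the smooth functions f on E^k.
   Functions on E^k are represented by extensions to J^k pi (the total
   derivatives are tangent to the equation, so the choice of extension is
   irrelevant); F is an extension of f o phi^(k). Assuming r <= k + 1 loses
   nothing as functions of lower order are also functions of order k. *)
Definition invariant_derivation r (X : hfield r) : Prop :=
  forall (U : set 'rV[R]_4) (phi : 'rV[R]_4 -> 'rV[R]_4),
    in_pseudogroup U phi ->
    forall k, (r <= k.+1)%N -> forall t t' : jet k.+1, prolonged U phi t t' ->
    hdom X (jproj r t) ->
    hdom X (jproj r t') /\
    forall f F : jet k -> R,
      smooth_at (jproj k t') f -> smooth_at (jproj k t) F ->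
      (\forall e \near jproj k t,
         forall e' : jet k, prolonged U phi e e' -> F e = f e') ->
      happly X F t = happly X f t'.

Inductive jet_polynomial k : (jet k -> R) -> Prop :=
| JPconst (c : R) : jet_polynomial (fun=> c)
| JPcoord a j : jet_polynomial (fun t => t.2 a j)
| JPadd P Q : jet_polynomial P -> jet_polynomial Q ->
    jet_polynomial (fun t => P t + Q t)
| JPmul P Q : jet_polynomial P -> jet_polynomial Q ->
    jet_polynomial (fun t => P t * Q t).

(* A subset O of E^k that meets each fiber of E^k over J^0 pi in a nonempty
   Zariski open subset (the complement of the common zeros of a set S of
   polynomials; coordinates of order 0 are constant on the fiber). *)
Definition zariski_open_in_fibers k (O : set (jet k)) : Prop :=
  O `<=` @kundt_jet k /\
  forall t0 : jet 0, kundt_jet t0 ->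
    let fiber := @kundt_jet k `&` [set t | jproj 0 t = t0] in
    O `&` fiber !=set0 /\
    exists S : set (jet k -> R), S `<=` @jet_polynomial k /\
      O `&` fiber = fiber `&` [set t | exists2 P, S P & P t != 0].

Definition independent_on n r (X : 'I_n -> hfield r) (O : set (jet r)) : Prop :=
  forall t, O t ->
    (forall i, hdom (X i) t) /\ row_free (\matrix_(i < n) hcoef (X i) t).

End Jets.

Section Derivations.
Variable R : realType.

Definition deth k (t : jet R k) : R :=
  jd t ch11 [::] * jd t ch22 [::] - jd t ch12 [::] ^+ 2.

Definition I1num k (t : jet R k) : R :=
  jd t cW1 [:: iv] ^+ 2 * jd t ch22 [::]
  - 2%:R * jd t cW1 [:: iv] * jd t cW2 [:: iv] * jd t ch12 [::]
  + jd t cW2 [:: iv] ^+ 2 * jd t ch11 [::].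

Definition I1 (t : jet R 1) : R := I1num t / deth t.

Definition kA k (t : jet R k) : R :=
  jd t cW1 [:: iv] * jd t ch22 [::] - jd t cW2 [:: iv] * jd t ch12 [::].

Definition kB k (t : jet R k) : R :=
  jd t cW1 [:: iv] * jd t ch12 [::] - jd t cW2 [:: iv] * jd t ch11 [::].

Definition T0 (t : jet R 2) : R :=
  let A := kA t in let B := kB t in
  A ^+ 3 * jd t ch11 [:: ix1]
  - (jd t ch11 [:: ix2] + 2%:R * jd t ch12 [:: ix1]) * A ^+ 2 * B
  + (jd t ch22 [:: ix1] + 2%:R * jd t ch12 [:: ix2]) * A * B ^+ 2
  - B ^+ 3 * jd t ch22 [:: ix2]
  - 2%:R * deth t *
    (A ^+ 2 * jd t cW1 [:: ix1; iv] + B ^+ 2 * jd t cW2 [:: ix2; iv]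
     - A * B * (jd t cW1 [:: ix2; iv] + jd t cW2 [:: ix1; iv])).

Definition den1 (t : jet R 2) : R :=
  kA t * jd t cW1 [:: iv; iv] - kB t * jd t cW2 [:: iv; iv].

Definition T1 (t : jet R 2) : R := 2%:R * deth t * den1 t.

Definition den2 (t : jet R 2) : R :=
  jd t cW1 [:: iv] * jd t cW2 [:: iv; iv]
  - jd t cW2 [:: iv] * jd t cW1 [:: iv; iv].

Definition nabla1 : hfield R 2 := HField
  [set t | kundt_jet t /\ den1 t != 0]
  (fun t => (I1num t / den1 t) *: delta_mx 0 iv).

Definition nabla2 : hfield R 2 := HField
  [set t | kundt_jet t /\ den2 t != 0]
  (fun t => (den2 t)^-1 *:
    (jd t cW2 [:: iv; iv] *: delta_mx 0 ix1
     - jd t cW1 [:: iv; iv] *: delta_mx 0 ix2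
     + (jd t cW1 [:: ix2; iv] - jd t cW2 [:: ix1; iv]) *: delta_mx 0 iv)).

Definition nabla3 : hfield R 2 := HField
  [set t | kundt_jet t /\ T1 t != 0]
  (fun t => (deth t)^-1 *:
    (kA t *: delta_mx 0 ix1 - kB t *: delta_mx 0 ix2
     + (T0 t / T1 t) *: delta_mx 0 iv)).

Definition hdiff k (f : jet R k -> R) (t : jet R k.+1) : 'rV[R]_4 :=
  \row_i total_deriv i f t.

(* g(X, .) = omega reads X *m G = omega, G being the Gram matrix of g. *)
Definition sharp k (t : jet R k) (omega : 'rV[R]_4) : 'rV[R]_4 :=
  omega *m invmx (kundt_metric (jfib t)).

Definition nabla4 : hfield R 2 := HField
  (@kundt_jet R 2) (fun t => sharp t (hdiff I1 t)).

Definition nabla : 'I_4 -> hfield R 2 :=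
  tnth [tuple nabla1; nabla2; nabla3; nabla4].

End Derivations.

(* Main.v *)
Require Import Defs.
From mathcomp Require Import all_boot all_order all_algebra.
From mathcomp Require Import all_classical all_reals all_analysis.
From mathcomp Require Import ring lra.
Set Implicit Arguments.
Unset Strict Implicit.
Unset Printing Implicit Defensive.
Import Order.TTheory GRing.Theory Num.Theory.
Import numFieldNormedType.Exports.
Local Open Scope classical_set_scope.
Local Open Scope ring_scope.

(* Let phi map the metric of s to the metric of s'. Since total derivatives of
   a function on jets are derivatives of its composites with holonomic sections,
   a horizontal field X is invariant as soon as the Jacobian of phi takes the
   coefficients of X at j^2 s to those at j^2 s' (invariant_derivation_jets).

   Write w_j = (W_j)_v, a for the x-block of the Jacobian J of phi, and k for its
   vv entry. Comparing the entries of g = phi^* g' gives h = a h' a^T and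
   w = a w', so I_1 = |w|_h^2 is invariant; a further v-derivative gives
   w_v = k a w'_v. Then
   - nabla_1 = |w|^2 / <w, w_v> D_v;
   - nabla_2 is the kernel of d(w_1 dx^1 + w_2 dx^2) on the slices u = const,
     normalized by the volume form w /\ dw;
   - nabla_3 is the unique vector tangent to the slice that projects to the
     h-dual of w and kills I_1 (unique because (I_1)_v = 2 <w, w_v> <> 0);
   - nabla_4 is the g-gradient of I_1.

   All four are defined where den1 den2 <> 0. There they are independent: only
   nabla_4 has a u-component, which is 2 (I_1)_v, the x-parts of nabla_2 and
   nabla_3 have determinant proportional to den1, and nabla_1 is a nonzero
   multiple of D_v. *)

(** * Symmetry of second derivatives *)

Lemma dist_le_half2 (R : realType) (e a b y z : R) :
  y = z -> `|a - y| < e / 2 -> `|b - z| < e / 2 -> `|a - b| <= e.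
Proof.
move=> <- ay yb; rewrite -(subrK y a) -addrA [e]splitr.
by rewrite (le_trans (ler_normD _ _)) // lerD ?ltW // distrC.
Qed.

Section MixedDerivatives.
Variables (R : realType) (V : normedModType R).
Implicit Types (f : V -> R) (x v w : V) (N : set V).

Lemma is_derive_line f x v (t : R) : derivable f (x + t *: v) v ->
  is_derive t 1 (fun r => f (x + r *: v)) ('D_v f (x + t *: v)).
Proof.
have E : (fun h : R => h^-1 *: (f (x + (h%:A + t) *: v) - f (x + t *: v)))
   = (fun h : R => h^-1 *: (f (h *: v + (x + t *: v)) - f (x + t *: v))).
  apply/funext => h; congr (_ *: (f _ - _)).
  by rewrite [h%:A](mulr1) scalerDl addrCA.
by move=> df; split; rewrite /derivable /derive /= E.
Qed.

Lemma MVT_line f x v (h : R) : 0 < h ->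
  (forall t, t \in `[0, h] -> derivable f (x + t *: v) v) ->
  exists2 c, c \in `[0, h] &
    f (x + h *: v) - f x = 'D_v f (x + c *: v) * h.
Proof.
move=> h0 df.
have [c ch E] : exists2 c, c \in `[0, h] &
    f (x + h *: v) - f (x + 0 *: v) = 'D_v f (x + c *: v) * (h - 0).
  apply: (@MVT_segment R (fun r => f (x + r *: v))
    (fun r => 'D_v f (x + r *: v))) => //.
  - exact: ltW.
  - by move=> t th; apply: is_derive_line; apply: df; apply: subset_itv_oo_cc.
  - apply: derivable_within_continuous => t th.
    by have [] := is_derive_line (df _ th).
by exists c => //; move: E; rewrite scale0r addr0 subr0.
Qed.

(** Two mean value theorems in succession: along [v] for the increment [g y = f (y + h *: w) - f y],
    then along [w] for ['D_v f] at the intermediate point. *)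
Lemma second_difference f x v w (h : R) : 0 < h ->
  (forall s t, s \in `[0, h] -> t \in `[0, h] ->
     derivable f (x + s *: v + t *: w) v /\
     derivable ('D_v f) (x + s *: v + t *: w) w) ->
  exists s t, [/\ s \in `[0, h], t \in `[0, h] &
    f (x + h *: v + h *: w) - f (x + h *: v) - (f (x + h *: w) - f x)
    = 'D_w ('D_v f) (x + s *: v + t *: w) * h * h].
Proof.
move=> h0 df.
have z0h : 0 \in `[0, h] by rewrite in_itv /= lexx ltW.
have hh : h \in `[0, h] by rewrite in_itv /= lexx ltW.
pose g y := f (y + h *: w) - f y.
have dg s : s \in `[0, h] ->
    is_derive (x + s *: v) v g
      ('D_v f (x + s *: v + h *: w) - 'D_v f (x + s *: v)).
  move=> sh; apply: is_deriveB; last first.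
    apply: derivableP; have [] := df s 0 sh z0h.
    by rewrite scale0r addr0.
  have [d1 _] := df s h sh hh.
  have E : (fun k : R => k^-1 *: (f (k *: v + (x + s *: v) + h *: w)
                       - f (x + s *: v + h *: w)))
     = (fun k : R => k^-1 *: (f (k *: v + (x + s *: v + h *: w))
                       - f (x + s *: v + h *: w))).
    by apply/funext => k; rewrite !addrA.
  by split; rewrite /derivable /derive /= E.
have [s sh Es] : exists2 s, s \in `[0, h] &
    g (x + h *: v) - g x = 'D_v g (x + s *: v) * h.
  by apply: MVT_line => // t th; have [] := dg t th.
have [t th Et] : exists2 t, t \in `[0, h] &
    'D_v f (x + s *: v + h *: w) - 'D_v f (x + s *: v)
    = 'D_w ('D_v f) (x + s *: v + t *: w) * h.
  apply: (@MVT_line ('D_v f) _ _ _ h0) => t th; exact: (df s t sh th).2.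
exists s, t; split=> //.
by have [_ Eg] := dg s sh; rewrite -Et -Eg -Es.
Qed.

(* The second difference of f over a small parallelogram is symmetric in v and
   w, and equals h^2 times either mixed derivative at a nearby point. *)
Lemma derive_comm f N q v w : open N -> N q ->
  (forall x, N x -> [/\ derivable f x v, derivable f x w,
     derivable ('D_v f) x w & derivable ('D_w f) x v]) ->
  {for q, continuous ('D_w ('D_v f))} ->
  {for q, continuous ('D_v ('D_w f))} ->
  'D_w ('D_v f) q = 'D_v ('D_w f) q.
Proof.
move=> oN Nq df c1 c2.
apply/eqP; rewrite -subr_eq0 -normr_eq0 eq_le normr_ge0 andbT.
apply/ler_addgt0Pl => e e0; rewrite addr0.
have e20 : 0 < e / 2 by rewrite divr_gt0.
move/cvgrPdist_lt : c1 => /(_ _ e20) c1; move/cvgrPdist_lt : c2 => /(_ _ e20) c2.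
have nN : nbhs q N by exact: open_nbhs_nbhs.
have /nbhs_ballP[/= r r0 Hr] : nbhs q (N `&`
   ([set t | `|'D_w ('D_v f) q - 'D_w ('D_v f) t| < e / 2] `&`
    [set t | `|'D_v ('D_w f) q - 'D_v ('D_w f) t| < e / 2])).
  exact: (filterI nN (filterI c1 c2)).
(* With h m = r / 2, every s v + t w with s, t in [0, h] has norm at most r / 2, so the
   parallelogram stays in the ball of radius r. The summand 1 keeps m positive when v = w = 0. *)
pose m := `|v| + `|w| + 1.
have m0 : 0 < m by rewrite /m ltr_wpDl // addr_ge0.
pose h := r / 2 / m.
have h0 : 0 < h by rewrite !divr_gt0.
have Hb s t : s \in `[0, h] -> t \in `[0, h] -> ball q r (q + s *: v + t *: w).
  rewrite !in_itv /= => /andP[s0 sh] /andP[t0 th].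
  rewrite -ball_normE /= -addrA opprD addrA subrr add0r normrN.
  apply: (le_lt_trans (ler_normD _ _)); rewrite !normrZ !ger0_norm //.
  apply: (@le_lt_trans _ _ (h * m)).
    rewrite /m !mulrDr mulr1 -[leLHS]addr0.
    by apply: lerD; [apply: lerD; rewrite ler_wpM2r|exact: ltW].
  by rewrite /h divfK ?gt_eqF // ltr_pdivrMr // mulr_natr mulr2n ltrDl.
have [s [t [sh th E1]]] : exists s t, [/\ s \in `[0, h], t \in `[0, h] &
    f (q + h *: v + h *: w) - f (q + h *: v) - (f (q + h *: w) - f q)
    = 'D_w ('D_v f) (q + s *: v + t *: w) * h * h].
  apply: (second_difference h0) => s t sh th.
  have [Nx _] := Hr _ (Hb _ _ sh th); have [d1 _ d2 _] := df _ Nx.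
  exact: (conj d1 d2).
have [t' [s' [th' sh' E2]]] : exists s t, [/\ s \in `[0, h], t \in `[0, h] &
    f (q + h *: w + h *: v) - f (q + h *: w) - (f (q + h *: v) - f q)
    = 'D_v ('D_w f) (q + s *: w + t *: v) * h * h].
  apply: (second_difference h0) => s' t' sh' th'; rewrite addrAC.
  have [Nx _] := Hr _ (Hb _ _ th' sh'); have [_ d1 _ d2] := df _ Nx.
  exact: (conj d1 d2).
have E : 'D_w ('D_v f) (q + s *: v + t *: w)
       = 'D_v ('D_w f) (q + s' *: v + t' *: w).
  rewrite [in RHS]addrAC.
  have hN0 : h != 0 by rewrite gt_eqF.
  apply: (mulIf hN0); apply: (mulIf hN0).
  apply: (etrans (esym E1)); apply: (etrans _ E2); rewrite (addrAC q (h *: w)).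
  by move: (f _) (f _) (f _) (f _) => a b c d; ring.
have [_ [b1 _]] := Hr _ (Hb _ _ sh th).
have [_ [_ b2]] := Hr _ (Hb _ _ sh' th').
exact: dist_le_half2 E b1 b2.
Qed.
End MixedDerivatives.

(** * Smooth functions *)

Section Smooth.
Variables (R : realType).

(** The first-order expansion of f at x is also one of g, since they agree near x; uniqueness of the
    differential then gives ['d g x = 'd f x]. *)
Lemma near_eq_differentiable (V W : normedModType R) (f g : V -> W) x :
  {near x, f =1 g} -> differentiable f x -> differentiable g x.
Proof.
move=> fg df.
have dc : continuous ('d f x) by exact: diff_continuous.
have gE : g \o shift x = cst (g x) + 'd f x +o_ 0 id.
  apply/eqaddoP => _/posnumP[e].
  have /eqaddoP /(_ e%:num) /(_ [gt0 of e%:num]) := diff_locally df.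
  have fgx : f x = g x by exact: (nbhs_singleton fg).
  have fg0 : \forall h \near (0 : V), f (h + x) = g (h + x).
    move: fg; rewrite (near_shift 0) /=.
    by apply: filterS => h; rewrite /= subr0.
  apply: filterS2 fg0 => h E; rewrite !fctE /= -E -fgx; apply.
have dE := diff_unique dc gE.
by apply/diff_locallyP; split; rewrite dE; [exact: dc | exact: gE].
Qed.

Lemma near_eq_open (V : normedModType R) (T : Type) (N : set V) (f g : V -> T) x :
  open N -> (forall y, N y -> f y = g y) -> N x -> {near x, f =1 g}.
Proof.
move=> oN fg Nx; have nN : nbhs x N by exact: open_nbhs_nbhs.
exact: filterS fg nN.
Qed.

(** Openness of N is what carries the induction: functions equal on N are equal near each of its
    points, hence so are their derivatives on N. *)
Lemma Cn_on_eq (V W : normedModType R) n (N : set V) (f g : V -> W) :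
  open N -> (forall x, N x -> f x = g x) -> Cn_on n N f -> Cn_on n N g.
Proof.
move=> oN; elim: n f g => [|n IH] f g fg /=.
  move=> cf x Nx; have fgx := near_eq_open oN fg Nx.
  rewrite /prop_for /continuous_at -(fg _ Nx).
  exact: cvg_trans (near_eq_cvg fgx) (cf _ Nx).
case=> df Df; split=> [x Nx|w].
  exact: near_eq_differentiable (near_eq_open oN fg Nx) (df _ Nx).
apply: IH (Df w) => x Nx; apply: near_eq_derive.
exact: near_eq_open oN fg Nx.
Qed.

Lemma Cn_on_coord (V : normedModType R) m k n (N : set V) (f : V -> 'M[R]_(m, k))
    i j : open N -> Cn_on n N f -> Cn_on n N (fun x => f x i j).
Proof.
move=> oN; elim: n f => [|n IH] f /=.
  move=> cf x Nx; apply: (@continuous_comp _ _ _ f (fun M => M i j)).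
    exact: cf.
  exact: coord_continuous.
case=> df Df; split=> [x Nx|w].
  apply: (@differentiable_comp _ _ _ _ f (fun M => M i j)).
    exact: df.
  exact: differentiable_coord.
(* A coordinate of the derivative is the derivative of the coordinate only where f is derivable,
   hence the passage through equality on N. *)
apply: Cn_on_eq (IH _ (Df w)) => // x Nx.
have dx : derivable f x w by apply: diff_derivable; exact: df.
by rewrite derive_mx // mxE.
Qed.

Lemma smooth_on_coord (V : normedModType R) m k (N : set V) (f : V -> 'M[R]_(m, k))
    i j : open N -> smooth_on N f -> smooth_on N (fun x => f x i j).
Proof. by move=> oN sf n; apply: Cn_on_coord. Qed.

Lemma smooth_on_differentiable (V W : normedModType R) (N : set V) (f : V -> W) x :
  smooth_on N f -> N x -> differentiable f x.
Proof. by move=> /(_ 1%N)[df _]; apply: df. Qed.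

Lemma smooth_on_derive (V W : normedModType R) (N : set V) (f : V -> W) w :
  smooth_on N f -> smooth_on N ('D_w f).
Proof. by move=> sf n; have [_] := sf n.+1; apply. Qed.

Lemma smooth_on_partial (N : set 'rV[R]_4) (f : 'rV[R]_4 -> R) i :
  smooth_on N f -> smooth_on N (partial i f).
Proof. exact: smooth_on_derive. Qed.

Lemma smooth_on_derivable (V W : normedModType R) (N : set V) (f : V -> W) x v :
  smooth_on N f -> N x -> derivable f x v.
Proof.
move=> sf Nx; apply: diff_derivable; exact: smooth_on_differentiable sf Nx.
Qed.

Lemma smooth_on_continuous (V W : normedModType R) (N : set V) (f : V -> W) x :
  smooth_on N f -> N x -> {for x, continuous f}.
Proof. by move=> /(_ 0%N) cf; apply: cf. Qed.

Lemma partial_comm (N : set 'rV[R]_4) (f : 'rV[R]_4 -> R) i j q :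
  open N -> smooth_on N f -> N q ->
  partial i (partial j f) q = partial j (partial i f) q.
Proof.
move=> oN sf Nq; have sfi := smooth_on_partial i sf.
have sfj := smooth_on_partial j sf.
apply: (@derive_comm R _ f N q (delta_mx 0 j) (delta_mx 0 i) oN Nq).
- move=> x Nx; split; first exact: smooth_on_derivable sf Nx.
  + exact: smooth_on_derivable sf Nx.
  + exact: smooth_on_derivable sfj Nx.
  + exact: smooth_on_derivable sfi Nx.
- exact: smooth_on_continuous (smooth_on_partial i sfj) Nq.
- exact: smooth_on_continuous (smooth_on_partial j sfi) Nq.
Qed.

Lemma near_eq_partial (f g : 'rV[R]_4 -> R) i (q : 'rV[R]_4) :
  (\forall x \near q, f x = g x) -> partial i f q = partial i g q.
Proof. exact: near_eq_derive. Qed.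

End Smooth.

(** * Jet coordinates *)

Section JetCoordinates.
Variable R : realType.

(** The exponents are an arbitrary function instead of a bounded multi-index, so that a multi-index
    can be raised by one without changing its type. *)
Definition mpartial (m : 'I_4 -> nat) (f : 'rV[R]_4 -> R) : 'rV[R]_4 -> R :=
  foldr (fun i g => iter (m i) (partial i) g) f (enum 'I_4).

Lemma enum_I4 : enum 'I_4 = [:: iu; ix1; ix2; iv].
Proof. by apply: (inj_map val_inj); rewrite val_enum_ord. Qed.

Lemma mpartialE m f : mpartial m f =
  iter (m iu) (partial iu) (iter (m ix1) (partial ix1)
    (iter (m ix2) (partial ix2) (iter (m iv) (partial iv) f))).
Proof. by rewrite /mpartial enum_I4. Qed.

Lemma I4P (P : 'I_4 -> Prop) : P iu -> P ix1 -> P ix2 -> P iv -> forall i, P i.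
Proof.
move=> Pu P1 P2 Pv i.
have : i \in enum 'I_4 by rewrite mem_enum.
by rewrite enum_I4 !inE => /or4P[] /eqP ->.
Qed.

Lemma smooth_on_iter (N : set 'rV[R]_4) f n j :
  smooth_on N f -> smooth_on N (iter n (partial j) f).
Proof. by move=> sf; elim: n => //= n IH; apply: smooth_on_partial. Qed.

Lemma smooth_on_mpartial (N : set 'rV[R]_4) m f :
  smooth_on N f -> smooth_on N (mpartial m f).
Proof. by move=> sf; rewrite mpartialE; do 4![apply: smooth_on_iter]. Qed.

Lemma iter_partial_eq (N : set 'rV[R]_4) f g n j : open N ->
  (forall q, N q -> f q = g q) ->
  forall q, N q -> iter n (partial j) f q = iter n (partial j) g q.
Proof.
move=> oN fg; elim: n => //= n IH q Nq; apply: near_eq_partial.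
exact: near_eq_open oN IH Nq.
Qed.

Lemma partial_iter (N : set 'rV[R]_4) f n i j : open N -> smooth_on N f ->
  forall q, N q ->
    partial i (iter n (partial j) f) q = iter n (partial j) (partial i f) q.
Proof.
move=> oN sf; elim: n => //= n IH q Nq.
rewrite (partial_comm _ _ oN _ Nq); last exact: smooth_on_iter.
apply: near_eq_partial; exact: near_eq_open oN IH Nq.
Qed.

(** The extra derivative is moved inwards, one block of iterated partials at a time, until it meets
    the block of its own variable. *)
Lemma partial_mpartial (N : set 'rV[R]_4) f m i : open N -> smooth_on N f ->
  forall q, N q ->
    partial i (mpartial m f) q = mpartial (fun l => m l + (l == i))%N f q.
Proof.
move=> oN sf.
have S n j g : smooth_on N g -> smooth_on N (iter n (partial j) g).
  exact: smooth_on_iter.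
have step i' n j g g' : smooth_on N g ->
    (forall q, N q -> partial i' g q = g' q) -> forall q, N q ->
    partial i' (iter n (partial j) g) q = iter n (partial j) g' q.
  move=> sg gg' q Nq; rewrite (partial_iter _ _ _ oN sg Nq).
  exact: (iter_partial_eq _ _ oN gg' Nq).
move=> q Nq; rewrite !mpartialE; move: i q Nq.
apply: I4P => q Nq; rewrite !eqE /= ?addn0 ?addn1 ?iterS //.
- apply: (step _ _ _ _ _ _ _ _ Nq) => //; do ?apply: (S) => //.
- apply: (step _ _ _ _ _ _ _ _ Nq) => [|q1 Nq1]; first by do ?apply: (S).
  by apply: (step _ _ _ _ _ _ _ _ Nq1) => //; do ?apply: (S).
- apply: (step _ _ _ _ _ _ _ _ Nq) => [|q1 Nq1]; first by do ?apply: (S).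
  apply: (step _ _ _ _ _ _ _ _ Nq1) => [|q2 Nq2]; first by do ?apply: (S).
  by apply: (step _ _ _ _ _ _ _ _ Nq2) => //; do ?apply: (S).
Qed.

Lemma mi_exists k (m : 'I_4 -> nat) : (\sum_i m i <= k)%N ->
  exists j : 'I_#|mi k|, forall i, (val (mi_at j) i = m i :> nat)%N.
Proof.
move=> mk.
have mb i : (m i < k.+1)%N by rewrite ltnS (leq_trans _ mk) // (bigD1 i) //= leq_addr.
have sk : (\sum_i ([ffun i => Ordinal (mb i)] : {ffun 'I_4 -> 'I_k.+1}) i <= k)%N.
  by rewrite (eq_bigr m) // => i _; rewrite ffunE.
exists (enum_rank (Sub [ffun i => Ordinal (mb i)] sk : mi k)) => i.
by rewrite /mi_at enum_rankK SubK ffunE.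
Qed.

(** The search in [jcoord] succeeds and its result is unique. The index j is chosen before the jet
    t, so the coordinate is a fixed matrix entry and hence linear in t. *)
Lemma jcoord_index k (m : 'I_4 -> nat) : (\sum_i m i <= k)%N ->
  exists2 j : 'I_#|mi k|, (fun i => val (mi_at j) i : nat) = m &
    forall (t : jet R k) a, jcoord t a m = t.2 a j.
Proof.
move=> /mi_exists[j jm]; exists j; first exact/funext.
move=> t a; rewrite /jcoord; case: pickP => [s /forallP sm|/(_ (mi_at j))].
  congr (t.2 a _); rewrite -[j]enum_valK; congr enum_rank.
  apply: val_inj; apply/ffunP => i; apply: val_inj => /=.
  by rewrite (eqP (sm i)) -jm.
by move/negP; case; apply/forallP => i; rewrite jm.
Qed.

Lemma jcoord_mx k p (F : 'I_6 -> ('I_4 -> nat) -> R) a m :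
  (\sum_i m i <= k)%N ->
  @jcoord R k (p, \matrix_(a, j) F a (fun l => val (mi_at j) l)) a m = F a m.
Proof. by move=> /jcoord_index[j <- ->]; rewrite mxE. Qed.

Lemma jcoord_jet_of k (s : 'rV[R]_4 -> 'rV[R]_6) p a m : (\sum_i m i <= k)%N ->
  jcoord (jet_of k s p) a m = mpartial m (fun q => s q 0 a) p.
Proof.
exact: (jcoord_mx p (fun a m => mpartial m (fun q => s q 0 a) p)).
Qed.

Lemma mi_at_sum k (j : 'I_#|mi k|) : (\sum_i val (mi_at j) i <= k)%N.
Proof. exact: valP (mi_at j). Qed.

Lemma jproj_jet_of k m (s : 'rV[R]_4 -> 'rV[R]_6) p :
  (k <= m)%N -> jproj k (jet_of m s p) = jet_of k s p.
Proof.
move=> km; congr (_, _); apply/matrixP => a j; rewrite !mxE jcoord_jet_of //.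
exact: leq_trans (mi_at_sum j) km.
Qed.

Lemma sum_count_mem (w : seq 'I_4) : (\sum_i count_mem i w)%N = size w.
Proof.
elim: w => [|x w IH] /=; first by rewrite big1.
rewrite big_split /= IH (bigD1 x) //= eqxx big1 ?addn0 // => i /negPf ix.
by rewrite eq_sym ix.
Qed.

Lemma jd_jet_of k (s : 'rV[R]_4 -> 'rV[R]_6) p a w : (size w <= k)%N ->
  jd (jet_of k s p) a w = mpartial (fun i => count_mem i w) (fun q => s q 0 a) p.
Proof. by move=> wk; rewrite /jd jcoord_jet_of ?sum_count_mem. Qed.

Lemma jfib_jet_of k (s : 'rV[R]_4 -> 'rV[R]_6) p : jfib (jet_of k s p) = s p.
Proof. by apply/rowP => a; rewrite mxE jd_jet_of //= mpartialE. Qed.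

End JetCoordinates.

(** * Total derivatives along jets of sections *)

Section JetDerivatives.
Variable R : realType.

Lemma differentiable_mx (V : normedModType R) m n (M : V -> 'M[R]_(m, n)) x :
  (forall i j, differentiable (fun y => M y i j) x) -> differentiable M x.
Proof.
move=> dM.
have -> : M = \sum_(i < m) \sum_(j < n) (fun y => M y i j *: delta_mx i j).
  apply/funext => y; rewrite fct_sumE [LHS]matrix_sum_delta.
  by apply: eq_bigr => i _; rewrite fct_sumE.
apply: differentiable_sum => i; apply: differentiable_sum => j.
exact: differentiableZl.
Qed.

Lemma partialE (f : 'rV[R]_4 -> R) i p :
  differentiable f p -> partial i f p = 'd f p (delta_mx 0 i).
Proof. exact: deriveE. Qed.

Lemma sum_partial (f : 'rV[R]_4 -> R) (X : 'rV[R]_4) p : differentiable f p ->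
  \sum_i X 0 i * partial i f p = 'd f p X.
Proof.
move=> df; rewrite [X in RHS]row_sum_delta linear_sum.
by apply: eq_bigr => i _; rewrite linearZ partialE.
Qed.

(** * Jets of a fixed smooth section *)

Section JetOf.
Variables (N : set 'rV[R]_4) (s : 'rV[R]_4 -> 'rV[R]_6).
Hypotheses (oN : open N) (ss : smooth_on N s).

Let ssc a : smooth_on N (fun q => s q 0 a).
Proof. exact: smooth_on_coord. Qed.

Let jmx k (q : 'rV[R]_4) : 'M[R]_(6, #|mi k|) :=
  \matrix_(a, j) multi_partial (mi_at j) (fun q => s q 0 a) q.

Let jmxE k a j : (fun q => jmx k q a j)
  = mpartial (fun i => val (mi_at j) i) (fun q => s q 0 a).
Proof. by apply/funext => q; rewrite mxE. Qed.

Let diff_jmx k p : N p -> differentiable (jmx k) p.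
Proof.
move=> Np; apply: differentiable_mx => a j; rewrite jmxE.
apply: smooth_on_differentiable Np; exact: smooth_on_mpartial.
Qed.

Lemma differentiable_jet_of k p : N p -> differentiable (jet_of k s) p.
Proof.
by move=> Np; apply: (@differentiable_pair _ _ _ _ id (jmx k)) (diff_jmx k Np).
Qed.

(** The total derivative vector is tangent to the image of a holonomic section: differentiating the
    entry of multi-index m raises m by one in the i-th place. *)
Lemma diff_jet_of k p i : N p ->
  'd (jet_of k s) p (delta_mx 0 i) = total_vector (jet_of k.+1 s p) i.
Proof.
move=> Np.
have -> : 'd (jet_of k s) p (delta_mx 0 i)
        = ('d id p (delta_mx 0 i), 'd (jmx k) p (delta_mx 0 i)).
  have did : differentiable (id : 'rV[R]_4 -> 'rV[R]_4) p by [].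
  exact: (congr1 (fun g => g (delta_mx 0 i)) (diff_pair did (diff_jmx k Np))).
rewrite /total_vector; congr (_, _); first by rewrite diff_val.
rewrite -deriveE; last exact: diff_jmx.
rewrite derive_mx; last by apply: diff_derivable; exact: diff_jmx.
apply/matrixP => a j; rewrite !mxE jmxE.
(* The raised multi-index has length at most k + 1, so [jcoord] does not fall back to its default
   0. *)
rewrite jcoord_jet_of; last first.
  have s1 : (\sum_(l < 4) (l == i) = 1)%N.
    by rewrite (bigD1 i) //= eqxx big1 // => l /negPf ->.
  by rewrite big_split /= s1 addn1 ltnS; apply: mi_at_sum.
exact: (partial_mpartial _ _ oN (ssc a) Np).
Qed.

Lemma total_deriv_jet_of k p i (f : jet R k -> R) : N p ->
  differentiable f (jet_of k s p) ->
  total_deriv i f (jet_of k.+1 s p) = partial i (f \o jet_of k s) p.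
Proof.
move=> Np df; rewrite /total_deriv jproj_jet_of // deriveE // -diff_jet_of //.
have dj := differentiable_jet_of k Np.
have dfj := differentiable_comp dj df.
by rewrite partialE // (diff_comp dj df).
Qed.

End JetOf.

Lemma smooth_at_differentiable (V W : normedModType R) (f : V -> W) x :
  smooth_at x f -> differentiable f x.
Proof. by case=> N [_ Nx sf]; apply: smooth_on_differentiable Nx. Qed.

Lemma happly_jet_of r (X : hfield R r) k (f : jet R k -> R) N s p :
  (r <= k.+1)%N -> kundt_on N s -> N p -> differentiable f (jet_of k s p) ->
  happly X f (jet_of k.+1 s p) = 'd (f \o jet_of k s) p (hcoef X (jet_of r s p)).
Proof.
move=> rk [oN ss _ _] Np df; rewrite /happly jproj_jet_of //.
rewrite -sum_partial; last first.
  exact: differentiable_comp (differentiable_jet_of oN ss k Np) df.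
by apply: eq_bigr => i _; rewrite (total_deriv_jet_of oN ss).
Qed.

Definition isometric_at (phi : 'rV[R]_4 -> 'rV[R]_4) s s' (p : 'rV[R]_4) : Prop :=
  kundt_metric (s p)
  = 'J phi p *m kundt_metric (s' (phi p)) *m ('J phi p)^T.

(** Along the two sections, F and f satisfy [F \o jet_of k s = f \o jet_of k s' \o phi] near p;
    differentiating this along the coefficients of X gives the claim. *)
Lemma invariant_derivation_jets r (X : hfield R r) :
  (forall U phi N N' s s' p, in_pseudogroup U phi -> U p -> N p -> N' (phi p) ->
     kundt_on N s -> kundt_on N' s' -> (\forall q \near p, isometric_at phi s s' q) ->
     hdom X (jet_of r s p) ->
     hdom X (jet_of r s' (phi p)) /\
     hcoef X (jet_of r s p) *m 'J phi p = hcoef X (jet_of r s' (phi p))) ->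
  invariant_derivation X.
Proof.
move=> HX U phi Gphi k rk t t' [p [N [N' [s [s' [[Up [Np N'p]] [Ks Ks'] iso -> ->]]]]]].
rewrite !jproj_jet_of // => Xp.
have [Xp' XJ] := HX _ _ _ _ _ _ _ Gphi Up Np N'p Ks Ks' iso Xp.
split=> // f F /smooth_at_differentiable df /smooth_at_differentiable dF Ff.
rewrite (happly_jet_of _ rk Ks Np dF) (happly_jet_of _ rk Ks' N'p df) -XJ.
have [[V [psi [[oU _] [sphi _] _ _]]] _] := Gphi.
have dphi : differentiable phi p by exact: smooth_on_differentiable Up.
have [oN ss _ _] := Ks; have [oN' ss' _ _] := Ks'.
have dj := differentiable_jet_of oN ss k Np.
have dj' := differentiable_jet_of oN' ss' k N'p.
have -> : hcoef X (jet_of r s p) *m 'J phi p = 'd phi p (hcoef X (jet_of r s p)).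
  by rewrite mul_rV_lin1.
(* The same pair of sections witnesses [prolonged] at every q near p, because the isometry holds
   near such q as well. *)
have E : \forall q \near p, (F \o jet_of k s) q
       = ((f \o jet_of k s') \o phi) q.
  have nU : nbhs p U by exact: open_nbhs_nbhs.
  have nN : nbhs p N by exact: open_nbhs_nbhs.
  have nN' : nbhs p (phi @^-1` N').
    by apply: (differentiable_continuous dphi); exact: open_nbhs_nbhs.
  have nF : \forall q \near p, forall e' : jet R k,
      prolonged U phi (jet_of k s q) e' -> F (jet_of k s q) = f e'.
    exact: (differentiable_continuous dj Ff).
  have niso := near_join iso.
  apply: filterS (filterI (filterI nU nN) (filterI nN' (filterI nF niso))).
  move=> q [[Uq Nq] [N'q [nFq isoq]]] /=; apply: nFq.
  by exists q, N, N', s, s'; split; [| | exact: isoq | |].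
have dfj := differentiable_comp dj' df.
set v := hcoef X _.
transitivity ('D_v (F \o jet_of k s) p).
  by rewrite (deriveE _ (differentiable_comp dj dF)).
rewrite (near_eq_derive _ E) (deriveE _ (differentiable_comp dphi dfj)).
exact: (congr1 (fun g => g v) (diff_comp dphi dfj)).
Qed.
End JetDerivatives.

(** * Algebra of Kundt metrics *)

Section KundtAlgebra.
Variable R : realType.

Lemma sum_I4 (V : nmodType) (F : 'I_4 -> V) :
  \sum_i F i = F iu + F ix1 + F ix2 + F iv.
Proof.
rewrite !big_ord_recr big_ord0 /= Monoid.mul1m.
by congr (F _ + F _ + F _ + F _); apply: val_inj.
Qed.

Lemma sum_I2 (V : nmodType) (F : 'I_2 -> V) : \sum_i F i = F 0 + F 1.
Proof.
rewrite big_ord_recl big_ord1; congr (_ + F _); exact: val_inj.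
Qed.

Lemma symprodE (a b : 'rV[R]_4) i j :
  symprod a b i j = (a 0 i * b 0 j + b 0 i * a 0 j) / 2.
Proof. by rewrite !mxE !big_ord1 !mxE mulrC. Qed.

(** Indicators of index equalities are used so that every entry reduces by computation once i and j
    are concrete. *)
Lemma kundt_metricE (y : 'rV[R]_6) i j : kundt_metric y i j =
  (iu == i)%:R * ((iv == j)%:R / 2 + y 0 cH * (iu == j)%:R / 2
     + y 0 cW1 * (ix1 == j)%:R / 2 + y 0 cW2 * (ix2 == j)%:R / 2)
  + (iu == j)%:R * ((iv == i)%:R / 2 + y 0 cH * (iu == i)%:R / 2
     + y 0 cW1 * (ix1 == i)%:R / 2 + y 0 cW2 * (ix2 == i)%:R / 2)
  + y 0 ch11 * (ix1 == i)%:R * (ix1 == j)%:R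
  + y 0 ch12 * ((ix1 == i)%:R * (ix2 == j)%:R + (ix2 == i)%:R * (ix1 == j)%:R)
  + y 0 ch22 * (ix2 == i)%:R * (ix2 == j)%:R.
Proof.
rewrite mxE symprodE !sum_I2 !mxE /= !big_ord1 !mxE /= ?(eq_sym _ i) ?(eq_sym _ j).
by field.
Qed.

(** * Entries of g = J g' J^T for J of the shape of a pseudogroup Jacobian *)

Section Isometry.
Variables (J : 'M[R]_4) (y y' : 'rV[R]_6).
Hypothesis iso : kundt_metric y = J *m kundt_metric y' *m J^T.
Hypotheses (J1u : J ix1 iu = 0) (J2u : J ix2 iu = 0).
Hypotheses (Jvu : J iv iu = 0) (Jv1 : J iv ix1 = 0) (Jv2 : J iv ix2 = 0).

Let isoE i j : kundt_metric y i j =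
  \sum_b (\sum_a J i a * kundt_metric y' a b) * J j b.
Proof.
rewrite iso mxE; apply: eq_bigr => b _; rewrite !mxE; congr (_ * _).
Qed.

(** Both metrics have the constant entry 1/2 in position uv, and the v row of J is supported on the
    diagonal. *)
Lemma isometry_uv : J iu iu * J iv iv = 1.
Proof.
have := isoE iu iv; rewrite !sum_I4 !kundt_metricE !eqE /= Jvu Jv1 Jv2.
lra.
Qed.

Lemma isometry_h11 : y 0 ch11 = J ix1 ix1 ^+ 2 * y' 0 ch11
  + 2 * J ix1 ix1 * J ix1 ix2 * y' 0 ch12 + J ix1 ix2 ^+ 2 * y' 0 ch22.
Proof.
have := isoE ix1 ix1; rewrite !sum_I4 !kundt_metricE !eqE /= J1u; lra.
Qed.

Lemma isometry_h12 : y 0 ch12 = J ix1 ix1 * J ix2 ix1 * y' 0 ch11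
  + (J ix1 ix1 * J ix2 ix2 + J ix1 ix2 * J ix2 ix1) * y' 0 ch12
  + J ix1 ix2 * J ix2 ix2 * y' 0 ch22.
Proof.
have := isoE ix1 ix2; rewrite !sum_I4 !kundt_metricE !eqE /= J1u J2u; lra.
Qed.

Lemma isometry_h22 : y 0 ch22 = J ix2 ix1 ^+ 2 * y' 0 ch11
  + 2 * J ix2 ix1 * J ix2 ix2 * y' 0 ch12 + J ix2 ix2 ^+ 2 * y' 0 ch22.
Proof.
have := isoE ix2 ix2; rewrite !sum_I4 !kundt_metricE !eqE /= J2u; lra.
Qed.

Lemma isometry_W1 : y 0 cW1 = J iu iu *
    (y' 0 cW1 * J ix1 ix1 + y' 0 cW2 * J ix1 ix2 + J ix1 iv)
  + 2 * (J iu ix1 * (y' 0 ch11 * J ix1 ix1 + y' 0 ch12 * J ix1 ix2)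
       + J iu ix2 * (y' 0 ch12 * J ix1 ix1 + y' 0 ch22 * J ix1 ix2)).
Proof.
have := isoE iu ix1; rewrite !sum_I4 !kundt_metricE !eqE /= J1u; lra.
Qed.

Lemma isometry_W2 : y 0 cW2 = J iu iu *
    (y' 0 cW1 * J ix2 ix1 + y' 0 cW2 * J ix2 ix2 + J ix2 iv)
  + 2 * (J iu ix1 * (y' 0 ch11 * J ix2 ix1 + y' 0 ch12 * J ix2 ix2)
       + J iu ix2 * (y' 0 ch12 * J ix2 ix1 + y' 0 ch22 * J ix2 ix2)).
Proof.
have := isoE iu ix2; rewrite !sum_I4 !kundt_metricE !eqE /= J2u; lra.
Qed.
End Isometry.

Lemma hmxE (y : 'rV[R]_6) (x : 'rV[R]_2) : (x *m hmx y *m x^T) 0 0 =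
  y 0 ch11 * x 0 0 ^+ 2 + 2 * y 0 ch12 * x 0 0 * x 0 1 + y 0 ch22 * x 0 1 ^+ 2.
Proof. rewrite !mxE !sum_I2 !mxE !sum_I2 !mxE /=; ring. Qed.

Lemma h_posdef_gt0 (y : 'rV[R]_6) : h_posdef y ->
  [/\ 0 < y 0 ch11, 0 < y 0 ch22 & 0 < y 0 ch11 * y 0 ch22 - y 0 ch12 ^+ 2].
Proof.
move=> hy.
have pos a b : (a != 0) || (b != 0) ->
    0 < y 0 ch11 * a ^+ 2 + 2 * y 0 ch12 * a * b + y 0 ch22 * b ^+ 2.
  move=> ab; pose x : 'rV[R]_2 := \row_i (if i == 0 then a else b).
  have x0 : x != 0.
    apply: contraTN ab => /eqP /rowP x0; rewrite negb_or !negbK.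
    by have := x0 0; have := x0 1; rewrite !mxE /= => -> ->; rewrite eqxx.
  by have := hy x x0; rewrite hmxE !mxE.
have h1 : 0 < y 0 ch11 by have := pos 1 0; rewrite oner_eq0 => /(_ isT); lra.
have h2 : 0 < y 0 ch22.
  by have := pos 0 1; rewrite oner_eq0 orbT => /(_ isT); lra.
(* On the vector (h_12, - h_11) the quadratic form takes the value h_11 det h. *)
split=> //; have := pos (y 0 ch12) (- y 0 ch11).
rewrite oppr_eq0 (gt_eqF h1) orbT => /(_ isT).
set a := y 0 ch11 in h1 *; set b := y 0 ch12; set c := y 0 ch22 => H.
by rewrite -(pmulr_lgt0 _ h1); move: H; congr (_ < _); ring.
Qed.

Lemma mulmx_rV4 n (x : 'rV[R]_4) (M : 'M[R]_(4, n)) j : (x *m M) 0 j =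
  x 0 iu * M iu j + x 0 ix1 * M ix1 j + x 0 ix2 * M ix2 j + x 0 iv * M iv j.
Proof. by rewrite mxE sum_I4. Qed.

Lemma rV4P (x y : 'rV[R]_4) : x 0 iu = y 0 iu -> x 0 ix1 = y 0 ix1 ->
  x 0 ix2 = y 0 ix2 -> x 0 iv = y 0 iv -> x = y.
Proof. by move=> ? ? ? ?; apply/rowP; apply: I4P. Qed.

(** For x in the left kernel, the v column gives x_u = 0, the x^1 and x^2 columns then form a linear
    system with the invertible matrix h, and the u column finally gives x_v = 0. *)
Lemma kundt_metric_unit (y : 'rV[R]_6) : h_posdef y -> kundt_metric y \in unitmx.
Proof.
move=> /h_posdef_gt0[_ _ d0]; rewrite -row_free_unit; apply: inj_row_free.
move=> x /rowP xG; have := xG iu; have := xG ix1; have := xG ix2; have := xG iv.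
rewrite !mulmx_rV4 !kundt_metricE !eqE /= !mxE => e1 e2 e3 e4.
have xu : x 0 iu = 0 by lra.
have f1 : x 0 ix1 * y 0 ch11 + x 0 ix2 * y 0 ch12 = 0 by rewrite xu in e3; lra.
have f2 : x 0 ix1 * y 0 ch12 + x 0 ix2 * y 0 ch22 = 0 by rewrite xu in e2; lra.
have dN0 := gt_eqF d0.
have x1 : x 0 ix1 = 0.
  have : x 0 ix1 * (y 0 ch11 * y 0 ch22 - y 0 ch12 ^+ 2) = 0.
    transitivity ((x 0 ix1 * y 0 ch11 + x 0 ix2 * y 0 ch12) * y 0 ch22
      - (x 0 ix1 * y 0 ch12 + x 0 ix2 * y 0 ch22) * y 0 ch12); first by ring.
    by rewrite f1 f2 !mul0r subrr.
  by move/eqP; rewrite mulf_eq0 dN0 orbF => /eqP.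
have x2 : x 0 ix2 = 0.
  have : x 0 ix2 * (y 0 ch11 * y 0 ch22 - y 0 ch12 ^+ 2) = 0.
    transitivity ((x 0 ix1 * y 0 ch12 + x 0 ix2 * y 0 ch22) * y 0 ch11
      - (x 0 ix1 * y 0 ch11 + x 0 ix2 * y 0 ch12) * y 0 ch12); first by ring.
    by rewrite f1 f2 !mul0r subrr.
  by move/eqP; rewrite mulf_eq0 dN0 orbF => /eqP.
apply: rV4P; rewrite mxE //; rewrite xu x1 x2 in e4; lra.
Qed.
End KundtAlgebra.

(** * Derivation rules and the pseudogroup *)

Section PartialRules.
Variables (R : realType) (V : normedModType R) (q e : V).
Implicit Types f g : V -> R.

Lemma is_derive_add f g df dg : is_derive q e f df -> is_derive q e g dg ->
  is_derive q e (fun x => f x + g x) (df + dg).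
Proof. exact: is_deriveD. Qed.

Lemma is_derive_sub f g df dg : is_derive q e f df -> is_derive q e g dg ->
  is_derive q e (fun x => f x - g x) (df - dg).
Proof. exact: is_deriveB. Qed.

Lemma is_derive_mul f g df dg : is_derive q e f df -> is_derive q e g dg ->
  is_derive q e (fun x => f x * g x) (f q * dg + g q * df).
Proof. exact: is_deriveM. Qed.

Lemma is_derive_const (c : R) : is_derive q e (fun=> c) 0.
Proof. exact: is_derive_cst. Qed.

Lemma is_derive_sqr f df : is_derive q e f df ->
  is_derive q e (fun x => f x ^+ 2) (2 * f q * df).
Proof.
move=> fd; have -> : 2 * f q * df = f q * df + f q * df by ring.
exact: is_derive_mul.
Qed.
End PartialRules.

Section ChainRule.
Variable R : realType.
Implicit Types (phi : 'rV[R]_4 -> 'rV[R]_4) (q : 'rV[R]_4).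

Lemma jacobian_partial phi q i j : differentiable phi q ->
  'J phi q i j = partial i (fun x => phi x 0 j) q.
Proof.
move=> dphi; rewrite mxE -deriveE // derive_mx ?mxE //.
exact: diff_derivable.
Qed.

Lemma partial_comp phi (f : 'rV[R]_4 -> R) q i :
  differentiable phi q -> differentiable f (phi q) ->
  partial i (fun x => f (phi x)) q = \sum_j 'J phi q i j * partial j f (phi q).
Proof.
move=> dphi df; have dc := differentiable_comp dphi df.
apply: (etrans (partialE i dc)).
apply: (etrans (congr1 (fun g => g (delta_mx 0 i)) (diff_comp dphi df))).
rewrite /= -(sum_partial _ df); apply: eq_bigr => j _.
by rewrite -[in LHS]mul_rV_lin1 -rowE mxE.
Qed.

Lemma partial_shift_eq0 (f : 'rV[R]_4 -> R) i q :
  (forall h : R, f (h *: delta_mx 0 i + q) = f q) -> partial i f q = 0.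
Proof.
move=> fi; rewrite /partial /derive.
have -> : (fun h : R => h^-1 *: ((f \o shift q) (h *: delta_mx 0 i) - f q))
        = (fun=> 0).
  by apply/funext => h; rewrite /= fi subrr scaler0.
by apply: cvg_lim => //; apply: cvg_cst.
Qed.

Lemma shift_coord (q : 'rV[R]_4) (h : R) i j : j != i ->
  (h *: delta_mx 0 i + q) 0 j = q 0 j.
Proof. by move=> /negPf ji; rewrite !mxE ji mulr0 add0r. Qed.
End ChainRule.

Section Pseudogroup.
Variables (R : realType) (U : set 'rV[R]_4) (phi : 'rV[R]_4 -> 'rV[R]_4).
Hypothesis Gphi : in_pseudogroup U phi.

Lemma pseudogroup_open : open U.
Proof. by have [[V [psi [[oU _] _ _ _]]] _] := Gphi. Qed.

Lemma pseudogroup_smooth : smooth_on U phi.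
Proof. by have [[V [psi [_ [sphi _] _ _]]] _] := Gphi. Qed.

Lemma pseudogroup_u q i : U q -> i != iu -> partial i (fun x => phi x 0 iu) q = 0.
Proof.
have [_ [C [A [B [_ _ _ H]]]]] := Gphi => Uq iN.
have E x : U x -> phi x 0 iu = C (x 0 iu) by move=> /H [].
rewrite (near_eq_partial _ (near_eq_open pseudogroup_open E Uq)).
by apply: partial_shift_eq0 => h; rewrite shift_coord // eq_sym.
Qed.

Lemma pseudogroup_vx q (j : 'I_2) : U q -> partial iv (fun x => phi x 0 (ix j)) q = 0.
Proof.
have [_ [C [A [B [_ _ _ H]]]]] := Gphi => Uq.
have E x : U x -> phi x 0 (ix j) = A j (x 0 iu) (x 0 ix1) (x 0 ix2).
  by move=> /H [].
rewrite (near_eq_partial _ (near_eq_open pseudogroup_open E Uq)).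
by apply: partial_shift_eq0 => h; rewrite !shift_coord.
Qed.
End Pseudogroup.

(** * Equivalent Kundt metrics *)

(* xb b and cWb b are the positions of x^j and W_j, with j = 1 for b = false and
   j = 2 for b = true. *)
Definition xb (b : bool) : 'I_4 := if b then ix2 else ix1.
Definition cWb (b : bool) : 'I_6 := if b then cW2 else cW1.

Section KundtEquivalence.
Variables (R : realType) (U : set 'rV[R]_4) (phi : 'rV[R]_4 -> 'rV[R]_4).
Variables (N N' : set 'rV[R]_4) (s s' : 'rV[R]_4 -> 'rV[R]_6).
Hypothesis Gphi : in_pseudogroup U phi.
Hypotheses (Ks : kundt_on N s) (Ks' : kundt_on N' s').

(** The isometry is required in a neighbourhood of q, so that the condition is open and the
    identities drawn from it can be differentiated. *)
Definition equiv_at (q : 'rV[R]_4) : Prop :=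
  [/\ U q, N q, N' (phi q) & \forall x \near q, isometric_at phi s s' x].

Let oU : open U. Proof. exact: pseudogroup_open Gphi. Qed.
Let sphi : smooth_on U phi. Proof. exact: pseudogroup_smooth Gphi. Qed.
Let oN : open N. Proof. by case: Ks. Qed.
Let oN' : open N'. Proof. by case: Ks'. Qed.
Let ss a : smooth_on N (fun x => s x 0 a).
Proof. by case: Ks => _ ss _ _; apply: smooth_on_coord. Qed.
Let ss' a : smooth_on N' (fun x => s' x 0 a).
Proof. by case: Ks' => _ ss0 _ _; apply: smooth_on_coord. Qed.
Let dphi q : U q -> differentiable phi q.
Proof. exact: smooth_on_differentiable. Qed.

Lemma equiv_at_near q : equiv_at q -> \forall x \near q, equiv_at x.
Proof.
case=> Uq Nq N'q iso.
have nU : nbhs q U by exact: open_nbhs_nbhs.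
have nN : nbhs q N by exact: open_nbhs_nbhs.
have nN' : nbhs q (phi @^-1` N').
  by apply: (differentiable_continuous (dphi Uq)); exact: open_nbhs_nbhs.
have niso := near_join iso.
apply: filterS (filterI (filterI nU nN) (filterI nN' niso)).
by move=> x [[Ux Nx] [N'x isox]]; split.
Qed.

Definition jac i j : 'rV[R]_4 -> R := partial i (fun x => phi x 0 j).

Lemma smooth_jac i j : smooth_on U (jac i j).
Proof. by apply: smooth_on_partial; apply: smooth_on_coord. Qed.

Lemma jacE q i j : U q -> 'J phi q i j = jac i j q.
Proof. by move=> Uq; rewrite jacobian_partial //; apply: dphi. Qed.

Lemma jac_u q i : U q -> i != iu -> jac i iu q = 0.
Proof. exact: pseudogroup_u. Qed.

Lemma jac_vx q b : U q -> jac iv (xb b) q = 0.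
Proof.
move=> Uq; case: b; first exact: (pseudogroup_vx Gphi (1 : 'I_2) Uq).
exact: (pseudogroup_vx Gphi (0 : 'I_2) Uq).
Qed.

Lemma partial_jac q i j l : U q -> partial i (jac j l) q = partial j (jac i l) q.
Proof.
move=> Uq; apply: (partial_comm _ _ oU _ Uq).
by apply: smooth_on_coord.
Qed.

Lemma partial_eq0 (f : 'rV[R]_4 -> R) i q :
  (forall x, U x -> f x = 0) -> U q -> partial i f q = 0.
Proof.
move=> f0 Uq; rewrite (near_eq_partial i (near_eq_open (g := fun=> 0) oU f0 Uq)).
exact: derive_cst.
Qed.

(** Exchanging the two derivatives of phi brings the v-derivative to the front, where it vanishes on
    all of U because the u component does not involve v. *)
Lemma partial_v_jac_u q i : U q -> partial iv (jac i iu) q = 0.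
Proof.
by move=> Uq; rewrite partial_jac //; apply: partial_eq0 => // x Ux; apply: jac_u.
Qed.

Lemma partial_v_jac_x q i b : U q -> partial iv (jac i (xb b)) q = 0.
Proof.
by move=> Uq; rewrite partial_jac //; apply: partial_eq0 => // x Ux; apply: jac_vx.
Qed.

Section At.
Variable q : 'rV[R]_4.
Hypothesis Eq : equiv_at q.

Let Uq : U q. Proof. by case: Eq. Qed.
Let isoq : isometric_at phi s s' q.
Proof. by case: Eq => _ _ _ /nbhs_singleton. Qed.
Let J1u : 'J phi q ix1 iu = 0. Proof. by rewrite jacE // jac_u. Qed.
Let J2u : 'J phi q ix2 iu = 0. Proof. by rewrite jacE // jac_u. Qed.
Let Jvu : 'J phi q iv iu = 0. Proof. by rewrite jacE // jac_u. Qed.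
Let Jv1 : 'J phi q iv ix1 = 0. Proof. by rewrite jacE // (jac_vx false). Qed.
Let Jv2 : 'J phi q iv ix2 = 0. Proof. by rewrite jacE // (jac_vx true). Qed.

Lemma equiv_uv : jac iu iu q * jac iv iv q = 1.
Proof. by rewrite -!jacE //; apply: isometry_uv isoq Jvu Jv1 Jv2. Qed.

Lemma equiv_h11 : s q 0 ch11 = jac ix1 ix1 q ^+ 2 * s' (phi q) 0 ch11
  + 2 * jac ix1 ix1 q * jac ix1 ix2 q * s' (phi q) 0 ch12
  + jac ix1 ix2 q ^+ 2 * s' (phi q) 0 ch22.
Proof. by rewrite -!jacE //; apply: isometry_h11 isoq J1u. Qed.

Lemma equiv_h12 : s q 0 ch12 = jac ix1 ix1 q * jac ix2 ix1 q * s' (phi q) 0 ch11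
  + (jac ix1 ix1 q * jac ix2 ix2 q + jac ix1 ix2 q * jac ix2 ix1 q)
    * s' (phi q) 0 ch12
  + jac ix1 ix2 q * jac ix2 ix2 q * s' (phi q) 0 ch22.
Proof. by rewrite -!jacE //; apply: isometry_h12 isoq J1u J2u. Qed.

Lemma equiv_h22 : s q 0 ch22 = jac ix2 ix1 q ^+ 2 * s' (phi q) 0 ch11
  + 2 * jac ix2 ix1 q * jac ix2 ix2 q * s' (phi q) 0 ch12
  + jac ix2 ix2 q ^+ 2 * s' (phi q) 0 ch22.
Proof. by rewrite -!jacE //; apply: isometry_h22 isoq J2u. Qed.

Lemma equiv_W b : s q 0 (cWb b) = jac iu iu q *
    (s' (phi q) 0 cW1 * jac (xb b) ix1 q + s' (phi q) 0 cW2 * jac (xb b) ix2 q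
     + jac (xb b) iv q)
  + 2 * (jac iu ix1 q * (s' (phi q) 0 ch11 * jac (xb b) ix1 q
                         + s' (phi q) 0 ch12 * jac (xb b) ix2 q)
       + jac iu ix2 q * (s' (phi q) 0 ch12 * jac (xb b) ix1 q
                         + s' (phi q) 0 ch22 * jac (xb b) ix2 q)).
Proof.
rewrite -!jacE //; case: b.
- exact: isometry_W2 isoq J2u.
- exact: isometry_W1 isoq J1u.
Qed.

Lemma is_derive_jac i j l : is_derive q (delta_mx 0 l) (jac i j) (partial l (jac i j) q).
Proof. apply: derivableP; exact: smooth_on_derivable (smooth_jac i j) Uq. Qed.

Lemma is_derive_comp_phi f l : smooth_on N' f ->
  is_derive q (delta_mx 0 l) (fun x => f (phi x))
    (jac l iu q * partial iu f (phi q) + jac l ix1 q * partial ix1 f (phi q)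
     + jac l ix2 q * partial ix2 f (phi q) + jac l iv q * partial iv f (phi q)).
Proof.
have N'q : N' (phi q) by case: Eq.
move=> sf; have df := smooth_on_differentiable sf N'q.
rewrite -!jacE // -(sum_I4 (fun j => 'J phi q l j * partial j f (phi q))).
rewrite -(partial_comp _ (dphi Uq) df).
by apply: derivableP; apply: diff_derivable; exact: differentiable_comp (dphi Uq) df.
Qed.

Lemma is_derive_v_comp f : smooth_on N' f ->
  is_derive q (delta_mx 0 iv) (fun x => f (phi x))
    (jac iv iv q * partial iv f (phi q)).
Proof.
move=> sf; apply: is_derive_eq (is_derive_comp_phi iv sf) _.
have -> := jac_u Uq (isT : iv != iu).
have -> : jac iv ix1 q = 0 := jac_vx false Uq.
have -> : jac iv ix2 q = 0 := jac_vx true Uq.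
by move: (partial _ _ _) (partial _ _ _) (partial _ _ _) (partial _ _ _) => *; ring.
Qed.
End At.

(* J_vv = 1 / J_uu, and J_uu depends on u only. *)
Lemma partial_x_jac_vv q b : equiv_at q -> partial (xb b) (jac iv iv) q = 0.
Proof.
move=> Eq; have [Uq _ _ _] := Eq.
have E : \forall x \near q, jac iu iu x * jac iv iv x = 1.
  by apply: filterS (equiv_at_near Eq) => x; exact: equiv_uv.
have D := is_derive_mul (is_derive_jac Eq iu iu (xb b)) (is_derive_jac Eq iv iv (xb b)).
have c0 : partial (xb b) (jac iu iu) q = 0.
  rewrite partial_jac //; apply: partial_eq0 => // x Ux; apply: jac_u => //.
  by case: b {D}.
have [_ D1] := near_eq_is_derive E D; rewrite derive_cst c0 mulr0 addr0 in D1.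
have /eqP := esym D1; rewrite mulf_eq0 => /orP[/eqP c1|/eqP]; last exact.
exfalso; clear D D1; move: (equiv_uv Eq); rewrite c1 mul0r => /esym/eqP.
by rewrite oner_eq0.
Qed.

(** By symmetry this is an x-derivative of J_vv. It is the reason why the translation term of the v
    component disappears from (W_j)_v. *)
Lemma partial_v_jac_xv q b : equiv_at q -> partial iv (jac (xb b) iv) q = 0.
Proof.
by move=> Eq; have [Uq _ _ _] := Eq; rewrite partial_jac // partial_x_jac_vv.
Qed.

Let h_v a x : N' x -> is_h a -> partial iv (fun y => s' y 0 a) x = 0.
Proof. by case: Ks' => _ _ _; apply. Qed.

Definition Wv (r : 'rV[R]_4 -> 'rV[R]_6) b := partial iv (fun x => r x 0 (cWb b)).

Let sWv' b : smooth_on N' (Wv s' b). Proof. exact: smooth_on_partial. Qed.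

(** In [equiv_W], the Jacobian entries and h' are constant in v, so the v-derivative falls on W'
    alone; it produces the factor J_vv, which cancels the prefactor J_uu. *)
Lemma equiv_Wv q b : equiv_at q -> Wv s b q
  = jac (xb b) ix1 q * Wv s' false (phi q) + jac (xb b) ix2 q * Wv s' true (phi q).
Proof.
move=> Eq; have [Uq _ N'q _] := Eq.
have E := filterS (fun x Ex => esym (equiv_W Ex b)) (equiv_at_near Eq).
have Dx i b' : is_derive q (delta_mx 0 iv) (jac i (xb b')) 0.
  by rewrite -(partial_v_jac_x i b' Uq); exact: is_derive_jac.
have Du : is_derive q (delta_mx 0 iv) (jac iu iu) 0.
  by rewrite -(partial_v_jac_u iu Uq); exact: is_derive_jac.
have Dv : is_derive q (delta_mx 0 iv) (jac (xb b) iv) 0.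
  by rewrite -(partial_v_jac_xv b Eq); exact: is_derive_jac.
have Dh a : is_h a -> is_derive q (delta_mx 0 iv) (fun x => s' (phi x) 0 a) 0.
  move=> ha; have := is_derive_v_comp Eq (ss' a).
  by rewrite h_v // mulr0.
have D1 i := Dx i false; have D2 i := Dx i true.
have DW b' := is_derive_v_comp Eq (ss' (cWb b')).
have Dh1 := Dh ch11 isT; have Dh2 := Dh ch12 isT; have Dh3 := Dh ch22 isT.
have D :=
  is_derive_add
   (is_derive_mul Du (is_derive_add (is_derive_add
      (is_derive_mul (DW false) (D1 (xb b))) (is_derive_mul (DW true) (D2 (xb b)))) Dv))
   (is_derive_mul (is_derive_const _ _ 2) (is_derive_add
      (is_derive_mul (D1 iu) (is_derive_add (is_derive_mul Dh1 (D1 (xb b)))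
         (is_derive_mul Dh2 (D2 (xb b)))))
      (is_derive_mul (D2 iu) (is_derive_add (is_derive_mul Dh2 (D1 (xb b)))
         (is_derive_mul Dh3 (D2 (xb b))))))).
have [_ D'] := near_eq_is_derive (E _) D.
apply: (etrans D'); rewrite -/(Wv s' false) -/(Wv s' true).
have := equiv_uv Eq.
clear; rewrite /=.
move: (Wv s' false _) (Wv s' true _) (jac iu iu q) (jac iv iv q) => W1 W2 c k ck.
move: (jac (xb b) ix1 q) (jac (xb b) ix2 q) (jac (xb b) iv q) (jac iu ix1 q)
  (jac iu ix2 q) => a1 a2 a3 c1 c2; rewrite -[RHS]mul1r -ck.
by move: (s' (phi q)) => y; ring.
Qed.

(** The second v-derivative produces J_vv again, and this time no J_uu is left to cancel it. *)
Lemma equiv_Wvv q b : equiv_at q -> partial iv (Wv s b) q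
  = jac iv iv q * (jac (xb b) ix1 q * partial iv (Wv s' false) (phi q)
                   + jac (xb b) ix2 q * partial iv (Wv s' true) (phi q)).
Proof.
move=> Eq; have [Uq _ N'q _] := Eq.
have E := filterS (fun x Ex => esym (equiv_Wv b Ex)) (equiv_at_near Eq).
have Dx b' : is_derive q (delta_mx 0 iv) (jac (xb b) (xb b')) 0.
  by rewrite -(partial_v_jac_x (xb b) b' Uq); exact: is_derive_jac.
have DW b' := is_derive_v_comp Eq (sWv' b').
have [_ D] := near_eq_is_derive (E _)
  (is_derive_add (is_derive_mul (Dx false) (DW false))
                 (is_derive_mul (Dx true) (DW true))).
apply: (etrans D); clear; rewrite /=.
move: (Wv s' false _) (Wv s' true _) (partial iv (Wv s' false) _)
  (partial iv (Wv s' true) _) (jac iv iv q) => W1 W2 z1 z2 k.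
by move: (jac (xb b) ix1 q) (jac (xb b) ix2 q) => a1 a2; ring.
Qed.

Lemma partial_Wv q b l : equiv_at q -> l != iu ->
  partial l (Wv s b) q
  = jac (xb b) ix1 q * (jac l ix1 q * partial ix1 (Wv s' false) (phi q)
      + jac l ix2 q * partial ix2 (Wv s' false) (phi q)
      + jac l iv q * partial iv (Wv s' false) (phi q))
  + Wv s' false (phi q) * partial l (jac (xb b) ix1) q
  + (jac (xb b) ix2 q * (jac l ix1 q * partial ix1 (Wv s' true) (phi q)
      + jac l ix2 q * partial ix2 (Wv s' true) (phi q)
      + jac l iv q * partial iv (Wv s' true) (phi q))
  + Wv s' true (phi q) * partial l (jac (xb b) ix2) q).
Proof.
move=> Eq lu; have [Uq _ N'q _] := Eq.
have E := filterS (fun x Ex => esym (equiv_Wv b Ex)) (equiv_at_near Eq).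
have DW b' := is_derive_comp_phi Eq l (sWv' b').
have [_ D] := near_eq_is_derive (E _)
  (is_derive_add (is_derive_mul (is_derive_jac Eq (xb b) ix1 l) (DW false))
                 (is_derive_mul (is_derive_jac Eq (xb b) ix2 l) (DW true))).
apply: (etrans D); rewrite (jac_u Uq lu); clear; rewrite /=.
move: (Wv s' false _) (Wv s' true _) => W1 W2.
move: (partial iu (Wv s' false) _) (partial iu (Wv s' true) _)
  (partial ix1 (Wv s' false) _) (partial ix1 (Wv s' true) _)
  (partial ix2 (Wv s' false) _) (partial ix2 (Wv s' true) _)
  (partial iv (Wv s' false) _) (partial iv (Wv s' true) _)
  => u1 u2 w11 w12 w21 w22 wv1 wv2.
move: (partial l (jac (xb b) ix1) q) (partial l (jac (xb b) ix2) q) => p1 p2.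
move: (jac (xb b) ix1 q) (jac (xb b) ix2 q) (jac l ix1 q) (jac l ix2 q)
  (jac l iv q) => *.
ring.
Qed.

(** The second derivatives of phi in [partial_Wv] are symmetric and cancel in the
    antisymmetrization. What distinguishes the result from the law of a 2-form in the plane is the
    terms in w'_v, which come from the dependence of the v component of phi on x. *)
Lemma equiv_curl q : equiv_at q ->
  partial ix2 (Wv s false) q - partial ix1 (Wv s true) q
  = (jac ix1 ix1 q * jac ix2 ix2 q - jac ix1 ix2 q * jac ix2 ix1 q)
    * (partial ix2 (Wv s' false) (phi q) - partial ix1 (Wv s' true) (phi q))
  + partial iv (Wv s' false) (phi q)
    * (jac ix2 iv q * jac ix1 ix1 q - jac ix1 iv q * jac ix2 ix1 q)
  + partial iv (Wv s' true) (phi q)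
    * (jac ix2 iv q * jac ix1 ix2 q - jac ix1 iv q * jac ix2 ix2 q).
Proof.
move=> Eq; have [Uq _ _ _] := Eq.
have e1 := partial_jac ix2 ix1 ix1 Uq; have e2 := partial_jac ix2 ix1 ix2 Uq.
have f1 := partial_Wv false Eq (isT : ix2 != iu).
have f2 := partial_Wv true Eq (isT : ix1 != iu).
apply: (etrans (congr2 (fun a b => a - b) f1 f2)); move: e1 e2; clear; rewrite /=.
move: (partial ix1 (jac ix2 ix1) q) (partial ix1 (jac ix2 ix2) q)
  (partial ix2 (jac ix1 ix1) q) (partial ix2 (jac ix1 ix2) q) => p1 p2 _ _ -> ->.
move: (Wv s' false _) (Wv s' true _) => W1 W2.
move: (partial ix1 (Wv s' false) _) (partial ix1 (Wv s' true) _)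
  (partial ix2 (Wv s' false) _) (partial ix2 (Wv s' true) _)
  (partial iv (Wv s' false) _) (partial iv (Wv s' true) _) => w11 w12 w21 w22 wv1 wv2.
move: (jac ix1 ix1 q) (jac ix1 ix2 q) (jac ix2 ix1 q) (jac ix2 ix2 q)
  (jac ix1 iv q) (jac ix2 iv q) => *.
ring.
Qed.

Definition I1fun (r : 'rV[R]_4 -> 'rV[R]_6) x :=
  (Wv r false x ^+ 2 * r x 0 ch22 - 2 * Wv r false x * Wv r true x * r x 0 ch12
   + Wv r true x ^+ 2 * r x 0 ch11)
  / (r x 0 ch11 * r x 0 ch22 - r x 0 ch12 ^+ 2).

Lemma equiv_I1fun q : equiv_at q -> I1fun s q = I1fun s' (phi q).
Proof.
move=> Eq; have [Uq Nq N'q _] := Eq.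
have [_ _ hp _] := Ks; have [_ _ hp' _] := Ks'.
have [_ _ /gt_eqF d0] := h_posdef_gt0 (hp _ Nq).
have [_ _ /gt_eqF d0'] := h_posdef_gt0 (hp' _ N'q).
rewrite /I1fun !equiv_Wv //= in d0 d0' *.
move: d0; rewrite (equiv_h11 Eq) (equiv_h12 Eq) (equiv_h22 Eq).
move: (Wv s' false _) (Wv s' true _) => W1 W2; move: (phi q) d0' => q' d0' d0.
move: d0 d0'; move: (s' q' 0 ch11) (s' q' 0 ch12) (s' q' 0 ch22) => a b c.
move: (jac ix1 ix1 q) (jac ix1 ix2 q) (jac ix2 ix1 q) (jac ix2 ix2 q) => *.
by field; apply/andP; split; apply/negbT.
Qed.
End KundtEquivalence.

(** * The invariant I_1 on jets *)

Section JetQuantities.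
Variable R : realType.

(** The second case is that of words longer than k, where [jcoord] is 0 by convention. *)
Lemma jd_coordinate k a w : (exists j, forall t : jet R k, jd t a w = t.2 a j) \/
  (forall t : jet R k, jd t a w = 0).
Proof.
case: (leqP (\sum_i count_mem i w)%N k) => [wk|wk].
  by left; have [j _ E] := jcoord_index R wk; exists j => t; exact: E.
right=> t; rewrite /jd /jcoord; case: pickP => // s /forallP sm.
have := valP s; rewrite (eq_bigr _ (fun i _ => eqP (sm i))).
by rewrite leqNgt wk.
Qed.

Lemma differentiable_jd k (t : jet R k) a w : differentiable (fun t => jd t a w) t.
Proof.
case: (jd_coordinate k a w) => [[j E]|Z]; last first.
  by rewrite (funext Z); exact: differentiable_cst.
have -> : (fun t : jet R k => jd t a w)
        = (fun M : 'M[R]_(6, #|mi k|) => M a j) \o snd by exact/funext.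
apply: differentiable_comp.
  by apply: linear_differentiable => x; exact: cvg_snd.
exact: differentiable_coord.
Qed.

Lemma differentiable_deth k (t : jet R k) : differentiable (@deth R k) t.
Proof.
have D a : differentiable (fun t : jet R k => jd t a [::]) t.
  exact: differentiable_jd.
have M (f g : jet R k -> R) : differentiable f t -> differentiable g t ->
  differentiable (fun x => f x * g x) t by exact: differentiableM.
have B (f g : jet R k -> R) : differentiable f t -> differentiable g t ->
  differentiable (fun x => f x - g x) t by exact: differentiableB.
exact: B (M _ _ (D ch11) (D ch22)) (M _ _ (D ch12) (D ch12)).
Qed.

Lemma differentiable_I1 (t : jet R 1) : deth t != 0 -> differentiable (@I1 R) t.
Proof.
move=> dt.
have D a w : differentiable (fun t : jet R 1 => jd t a w) t.
  exact: differentiable_jd.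
have M (f g : jet R 1 -> R) : differentiable f t -> differentiable g t ->
  differentiable (fun x => f x * g x) t by exact: differentiableM.
have A (f g : jet R 1 -> R) : differentiable f t -> differentiable g t ->
  differentiable (fun x => f x + g x) t by exact: differentiableD.
have B (f g : jet R 1 -> R) : differentiable f t -> differentiable g t ->
  differentiable (fun x => f x - g x) t by exact: differentiableB.
have dd := differentiable_deth t.
have C (c : R) : differentiable (fun _ : jet R 1 => c) t by exact: differentiable_cst.
have dn : differentiable (@I1num R 1) t.
  apply: (A); last by apply: (M) => //; exact: M.
  apply: (B); first by apply: (M) => //; exact: M.
  by do 3![apply: (M) => //].
apply: (M _ _ dn); exact: differentiableV.
Qed.

Section JetOfKundt.
Variables (N : set 'rV[R]_4) (s : 'rV[R]_4 -> 'rV[R]_6).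
Hypothesis Ks : kundt_on N s.

Lemma jd0_jet_of k a p : jd (jet_of k s p) a [::] = s p 0 a.
Proof. by rewrite jd_jet_of //= mpartialE. Qed.

Lemma jdx_jet_of k a i p : jd (jet_of k.+1 s p) a [:: i] = partial i (fun x => s x 0 a) p.
Proof.
rewrite jd_jet_of // mpartialE; by elim/I4P: i.
Qed.

(** In [mpartial] the v-derivatives are innermost, so the identity holds by computation for every
    i. *)
Lemma jdW_jet_of k b i p :
  jd (jet_of k.+2 s p) (cWb b) [:: i; iv] = partial i (Wv s b) p.
Proof.
rewrite jd_jet_of // mpartialE; by elim/I4P: i.
Qed.

Lemma I1_jet_of : @I1 R \o jet_of 1 s = I1fun s.
Proof.
apply/funext => x; rewrite /= /I1 /I1num /deth !jd0_jet_of !jdx_jet_of.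
by rewrite /I1fun.
Qed.

Lemma deth_jet_of k p : deth (jet_of k s p)
  = s p 0 ch11 * s p 0 ch22 - s p 0 ch12 ^+ 2.
Proof. by rewrite /deth !jd0_jet_of. Qed.

Lemma kundt_jet_of k p : N p -> kundt_jet (jet_of k s p).
Proof.
have [oN ss hp hv] := Ks.
move=> Np; split; first by rewrite jfib_jet_of; exact: hp.
move=> a m ha; case E: (val m iv : nat) => [//|n] _.
rewrite mxE /mi_at enum_rankK.
change (mpartial (fun i => val m i) (fun q => s q 0 a) p = 0).
(* This exposes an innermost v-derivative of h; it vanishes on the open set N, and so do all its
   further derivatives. *)
rewrite mpartialE E iterSr.
have Z i f r : (forall x, N x -> f x = 0) ->
    forall x, N x -> iter r (partial i) f x = 0 :> R.
  move=> f0; elim: r => // r IH x Nx /=.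
  rewrite (near_eq_partial i (near_eq_open (g := fun=> 0) oN IH Nx)).
  exact: derive_cst.
by move: p Np; do 4![apply: (Z)]; move=> x Nx; exact: hv.
Qed.

Lemma deth_jet_of_neq0 k p : N p -> deth (jet_of k s p) != 0.
Proof.
move=> Np; have [_ _ hp _] := Ks; have [_ _ d0] := h_posdef_gt0 (hp _ Np).
by rewrite deth_jet_of gt_eqF.
Qed.

Lemma differentiable_I1fun p : N p -> differentiable (I1fun s) p.
Proof.
have [oN ss _ _] := Ks; move=> Np; rewrite -I1_jet_of.
apply: differentiable_comp; first exact: differentiable_jet_of Np.
by apply: differentiable_I1; exact: deth_jet_of_neq0.
Qed.

Lemma hdiff_I1_jet_of p : N p ->
  hdiff (@I1 R) (jet_of 2 s p) = \row_i partial i (I1fun s) p.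
Proof.
have [oN ss _ _] := Ks; move=> Np; apply/rowP => i; rewrite !mxE.
rewrite (total_deriv_jet_of oN ss _ Np) ?I1_jet_of //.
by apply: differentiable_I1; exact: deth_jet_of_neq0.
Qed.

(* Cleared of denominators, so that the product rule suffices. *)
Lemma partial_I1fun p i : N p ->
  let D := s p 0 ch11 * s p 0 ch22 - s p 0 ch12 ^+ 2 in
  let w b := Wv s b p in
  let dw b := partial i (Wv s b) p in
  let dh a := partial i (fun x => s x 0 a) p in
  partial i (I1fun s) p * D ^+ 2 =
  (w false ^+ 2 * dh ch22 + s p 0 ch22 * (2 * w false * dw false)
   - (2 * (w false * (w true * dh ch12 + s p 0 ch12 * dw true)
           + w true * s p 0 ch12 * dw false))
   + (w true ^+ 2 * dh ch11 + s p 0 ch11 * (2 * w true * dw true))) * D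
  - (w false ^+ 2 * s p 0 ch22 - 2 * w false * w true * s p 0 ch12
     + w true ^+ 2 * s p 0 ch11)
    * (s p 0 ch11 * dh ch22 + s p 0 ch22 * dh ch11 - 2 * s p 0 ch12 * dh ch12).
Proof.
move=> Np D w dw dh; have [oN ss hp hv] := Ks.
have sa a : smooth_on N (fun x => s x 0 a) by apply: smooth_on_coord.
have Dh a : is_derive p (delta_mx 0 i) (fun x => s x 0 a) (dh a).
  apply: derivableP; exact: smooth_on_derivable (sa a) Np.
have Dw b : is_derive p (delta_mx 0 i) (Wv s b) (dw b).
  apply: derivableP; apply: smooth_on_derivable Np; exact: smooth_on_partial.
have DI : is_derive p (delta_mx 0 i) (I1fun s) (partial i (I1fun s) p).
  by apply: derivableP; apply: diff_derivable; exact: differentiable_I1fun.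
have Dd := is_derive_sub (is_derive_mul (Dh ch11) (Dh ch22)) (is_derive_sqr (Dh ch12)).
have Dn := is_derive_add (is_derive_sub
    (is_derive_mul (is_derive_sqr (Dw false)) (Dh ch22))
    (is_derive_mul (is_derive_mul (is_derive_mul (is_derive_const _ _ 2) (Dw false))
       (Dw true)) (Dh ch12)))
  (is_derive_mul (is_derive_sqr (Dw true)) (Dh ch11)).
(* Both sides of I_1 det h = |w|^2 det h are differentiated, and the result is solved for the
   derivative of I_1. *)
have E : \forall x \near p, (I1fun s x * (s x 0 ch11 * s x 0 ch22 - s x 0 ch12 ^+ 2))
   = (Wv s false x ^+ 2 * s x 0 ch22 - 2 * Wv s false x * Wv s true x * s x 0 ch12
   + Wv s true x ^+ 2 * s x 0 ch11).
  apply: near_eq_open oN _ Np => x Nx; rewrite /I1fun divfK //.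
  by rewrite -(deth_jet_of 0); exact: deth_jet_of_neq0.
have [_ E1] := near_eq_is_derive E (is_derive_mul DI Dd).
have [_ E2] := Dn.
have E0 : I1fun s p * D = w false ^+ 2 * s p 0 ch22
   - 2 * w false * w true * s p 0 ch12 + w true ^+ 2 * s p 0 ch11.
  exact: nbhs_singleton E.
have := etrans (esym E1) E2; move: E0; rewrite -/(w false) -/(w true) -/D.
move: (partial i (I1fun s) p) (I1fun s p) => dI I; rewrite /D.
move: (w false) (w true) (dw false) (dw true) (dh ch11) (dh ch12) (dh ch22).
move: (s p 0 ch11) (s p 0 ch12) (s p 0 ch22).
clear => a b c w1 w2 dw1 dw2 da db dc e0 e1.
rewrite -e0; set d := a * c - b ^+ 2 in e0 e1 *.
have -> : dI * d ^+ 2 = (d * dI) * d by ring.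
rewrite (canRL (addKr _) e1); ring.
Qed.
End JetOfKundt.
End JetQuantities.

(** * The derivations on jets of Kundt metrics *)

Section NablaOfJets.
Variables (R : realType) (s : 'rV[R]_4 -> 'rV[R]_6) (p : 'rV[R]_4).

Notation w b := (Wv s b p).
Notation dw b i := (partial i (Wv s b) p).
Notation h a := (s p 0 a).
Notation dh a i := (partial i (fun x => s x 0 a) p).

Let W1_jet k : jd (jet_of k.+1 s p) cW1 [:: iv] = w false.
Proof. exact: jdx_jet_of. Qed.
Let W2_jet k : jd (jet_of k.+1 s p) cW2 [:: iv] = w true.
Proof. exact: jdx_jet_of. Qed.
Let dW1_jet k i : jd (jet_of k.+2 s p) cW1 [:: i; iv] = dw false i.
Proof. exact: jdW_jet_of k false i p. Qed.
Let dW2_jet k i : jd (jet_of k.+2 s p) cW2 [:: i; iv] = dw true i.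
Proof. exact: jdW_jet_of k true i p. Qed.

Definition jets_of_kundt := (jd0_jet_of, W1_jet, W2_jet, dW1_jet, dW2_jet).

Lemma kA_jet_of k : kA (jet_of k.+1 s p) = w false * h ch22 - w true * h ch12.
Proof. by rewrite /kA !jets_of_kundt. Qed.

Lemma kB_jet_of k : kB (jet_of k.+1 s p) = w false * h ch12 - w true * h ch11.
Proof. by rewrite /kB !jets_of_kundt. Qed.

Lemma I1num_jet_of k : I1num (jet_of k.+1 s p) =
  w false ^+ 2 * h ch22 - 2 * w false * w true * h ch12 + w true ^+ 2 * h ch11.
Proof. by rewrite /I1num !jets_of_kundt. Qed.

Lemma den1_jet_of : den1 (jet_of 2 s p) =
  (w false * h ch22 - w true * h ch12) * dw false iv
  - (w false * h ch12 - w true * h ch11) * dw true iv.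
Proof. by rewrite /den1 kA_jet_of kB_jet_of !jets_of_kundt. Qed.

Lemma den2_jet_of : den2 (jet_of 2 s p) =
  w false * dw true iv - w true * dw false iv.
Proof. by rewrite /den2 !jets_of_kundt. Qed.

Lemma T0_jet_of : T0 (jet_of 2 s p) =
  let A := w false * h ch22 - w true * h ch12 in
  let B := w false * h ch12 - w true * h ch11 in
  A ^+ 3 * dh ch11 ix1 - (dh ch11 ix2 + 2 * dh ch12 ix1) * A ^+ 2 * B
  + (dh ch22 ix1 + 2 * dh ch12 ix2) * A * B ^+ 2 - B ^+ 3 * dh ch22 ix2
  - 2 * (h ch11 * h ch22 - h ch12 ^+ 2) *
    (A ^+ 2 * dw false ix1 + B ^+ 2 * dw true ix2
     - A * B * (dw false ix2 + dw true ix1)).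
Proof. by rewrite /T0 kA_jet_of kB_jet_of deth_jet_of !jets_of_kundt !jdx_jet_of. Qed.

Lemma hcoef_nabla2 : hcoef (nabla2 R) (jet_of 2 s p) = (den2 (jet_of 2 s p))^-1 *:
  (dw true iv *: delta_mx 0 ix1 - dw false iv *: delta_mx 0 ix2
   + (dw false ix2 - dw true ix1) *: delta_mx 0 iv).
Proof. by rewrite /= !jets_of_kundt. Qed.
End NablaOfJets.

(** * Derivatives of I_1 in the directions of D_v and nabla_3 *)

Section Nabla3.
Variables (R : realType) (N : set 'rV[R]_4) (s : 'rV[R]_4 -> 'rV[R]_6).
Hypothesis Ks : kundt_on N s.
Variable p : 'rV[R]_4.
Hypothesis Np : N p.

Let dN0 := deth_jet_of_neq0 Ks 2 Np.

(** Since h does not depend on v, (I_1)_v = 2 <w, w_v>, and [den1] is <w, w_v> det h. *)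
Lemma partial_v_I1fun : partial iv (I1fun s) p * deth (jet_of 2 s p) ^+ 2
  = 2 * deth (jet_of 2 s p) * den1 (jet_of 2 s p).
Proof.
have [_ _ _ hv] := Ks.
rewrite deth_jet_of (partial_I1fun Ks _ Np) den1_jet_of !hv //.
move: (Wv s false p) (Wv s true p) (partial _ _ _) (partial _ _ _) => w1 w2 z1 z2.
by move: (s p 0 ch11) (s p 0 ch12) (s p 0 ch22) => a b c; clear; ring.
Qed.

(** This explains T: with D = det h, T_0 is - D^2 (A (I_1)_{x^1} - B (I_1)_{x^2}) and T_1 is D^2
    (I_1)_v, so T solves the equation nabla_3 I_1 = 0. *)
Lemma nabla3_I1 : den1 (jet_of 2 s p) != 0 ->
  \sum_i hcoef (nabla3 R) (jet_of 2 s p) 0 i * partial i (I1fun s) p = 0.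
Proof.
move=> d1; have T1N0 : T1 (jet_of 2 s p) != 0.
  by rewrite /T1 !mulf_neq0 // pnatr_eq0.
have E : kA (jet_of 2 s p) * (partial ix1 (I1fun s) p * deth (jet_of 2 s p) ^+ 2)
  - kB (jet_of 2 s p) * (partial ix2 (I1fun s) p * deth (jet_of 2 s p) ^+ 2)
  + T0 (jet_of 2 s p) = 0.
  rewrite kA_jet_of kB_jet_of T0_jet_of deth_jet_of.
  have e1 := partial_I1fun Ks ix1 Np; have e2 := partial_I1fun Ks ix2 Np.
  cbv zeta in e1, e2 |- *; rewrite e1 e2.
  clear; move: (Wv s false p) (Wv s true p) => w1 w2.
  move: (partial ix1 (Wv s false) p) (partial ix1 (Wv s true) p)
    (partial ix2 (Wv s false) p) (partial ix2 (Wv s true) p) => w11 w12 w21 w22.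
  move: (partial ix1 _ p) (partial ix1 _ p) (partial ix1 _ p).
  move: (partial ix2 _ p) (partial ix2 _ p) (partial ix2 _ p).
  by move: (s p 0 ch11) (s p 0 ch12) (s p 0 ch22) => *; ring.
have Ev := partial_v_I1fun.
rewrite sum_I4 /= !mxE !eqE /=.
move: dN0 d1 T1N0 E Ev; rewrite /T1.
move: (partial iu _ p) (partial ix1 _ p) (partial ix2 _ p) (partial iv _ p).
move: (kA _) (kB _) (T0 _) (deth _) (den1 _) => A B T d e.
clear => u x y v d0 e0 t0 E Ev.
have -> : T = - (A * (x * d ^+ 2) - B * (y * d ^+ 2)).
  by apply/eqP; rewrite -addr_eq0 addrC E.
have -> : v = 2 * e / d.
  by apply: (mulIf (expf_neq0 2 d0)); rewrite Ev; field.
by field; rewrite d0 e0.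
Qed.
End Nabla3.

(** * Equivariance of the derivations *)

(** Used with z = w_v, c the curl of w, a the x-block of the Jacobian and b its xv entries: the
    numerator of nabla_2 is pushed forward to d k times the one at the image jet. *)
Lemma nabla2_algebra (R : comRingType) (a11 a12 a21 a22 b1 b2 k : R)
    (z1 z2 c z1' z2' c' : R) (d := a11 * a22 - a12 * a21) :
  z1 = k * (a11 * z1' + a12 * z2') -> z2 = k * (a21 * z1' + a22 * z2') ->
  c = d * c' + z1' * (b2 * a11 - b1 * a21) + z2' * (b2 * a12 - b1 * a22) ->
  [/\ z2 * a11 - z1 * a21 = d * k * z2', z2 * a12 - z1 * a22 = d * k * - z1'
    & z2 * b1 - z1 * b2 + c * k = d * k * c'].
Proof. by rewrite /d => -> -> ->; split; ring. Qed.

Section Equivariance.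
Variables (R : realType) (U : set 'rV[R]_4) (phi : 'rV[R]_4 -> 'rV[R]_4).
Variables (N N' : set 'rV[R]_4) (s s' : 'rV[R]_4 -> 'rV[R]_6).
Hypothesis Gphi : in_pseudogroup U phi.
Hypotheses (Ks : kundt_on N s) (Ks' : kundt_on N' s').
Variable p : 'rV[R]_4.
Hypothesis Ep : equiv_at U phi N N' s s' p.

Let t := jet_of 2 s p.
Let t' := jet_of 2 s' (phi p).
Let J i j := jac phi i j p.
Let k := J iv iv.
Let d := J ix1 ix1 * J ix2 ix2 - J ix1 ix2 * J ix2 ix1.

Let Up : U p. Proof. by case: Ep. Qed.
Let Np : N p. Proof. by case: Ep. Qed.
Let N'p : N' (phi p). Proof. by case: Ep. Qed.

Let eW1 := equiv_Wv Gphi Ks Ks' false Ep.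
Let eW2 := equiv_Wv Gphi Ks Ks' true Ep.
Let eZ1 := equiv_Wvv Gphi Ks Ks' false Ep.
Let eZ2 := equiv_Wvv Gphi Ks Ks' true Ep.
Let eh11 := equiv_h11 Gphi Ep.
Let eh12 := equiv_h12 Gphi Ep.
Let eh22 := equiv_h22 Gphi Ep.

Let dphi : differentiable phi p.
Proof. exact: smooth_on_differentiable (pseudogroup_smooth Gphi) Up. Qed.

Ltac generalize_jets :=
  clear; rewrite /=;
  move: (Wv s' false (phi p)) (Wv s' true (phi p)) (partial iv (Wv s' false) (phi p))
    (partial iv (Wv s' true) (phi p)) => w1 w2 z1 z2;
  move: (s' (phi p) 0 ch11) (s' (phi p) 0 ch12) (s' (phi p) 0 ch22) => a b c;
  move: (jac phi ix1 ix1 p) (jac phi ix1 ix2 p) (jac phi ix2 ix1 p)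
    (jac phi ix2 ix2 p) (jac phi iv iv p) => *.

Lemma equiv_deth : deth t = d ^+ 2 * deth t'.
Proof.
rewrite /t /t' !deth_jet_of eh11 eh12 eh22 /d /J; generalize_jets; ring.
Qed.

(** The vector (A, - B) is det h times the h-dual of w; the dual is natural and det h has weight
    d^2. The x^2 component is [equiv_kB]. *)
Lemma equiv_kA : kA t * J ix1 ix1 - kB t * J ix2 ix1 = d ^+ 2 * kA t'.
Proof.
rewrite /t /t' !kA_jet_of !kB_jet_of eh11 eh12 eh22 eW1 eW2 /d /J.
generalize_jets; ring.
Qed.

Lemma equiv_kB : kA t * J ix1 ix2 - kB t * J ix2 ix2 = - (d ^+ 2 * kB t').
Proof.
rewrite /t /t' !kA_jet_of !kB_jet_of eh11 eh12 eh22 eW1 eW2 /d /J.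
generalize_jets; ring.
Qed.

Lemma equiv_I1num : I1num t = d ^+ 2 * I1num t'.
Proof.
rewrite /t /t' !I1num_jet_of eh11 eh12 eh22 eW1 eW2 /d /J.
generalize_jets; ring.
Qed.

(** The weight d^2 comes from det h in det h <w, w_v>, and k from w_v. Likewise [den2], being w /\
    w_v, has weight d k. *)
Lemma equiv_den1 : den1 t = d ^+ 2 * k * den1 t'.
Proof.
rewrite /t /t' !den1_jet_of eh11 eh12 eh22 eW1 eW2 eZ1 eZ2 /d /k /J.
generalize_jets; ring.
Qed.

Lemma equiv_den2 : den2 t = d * k * den2 t'.
Proof.
rewrite /t /t' !den2_jet_of eW1 eW2 eZ1 eZ2 /d /k /J.
generalize_jets; ring.
Qed.

Lemma equiv_d_neq0 : d != 0.
Proof.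
have := deth_jet_of_neq0 Ks 2 Np; rewrite -/t equiv_deth.
by apply: contraNneq => ->; rewrite expr0n mul0r.
Qed.

Lemma equiv_k_neq0 : k != 0.
Proof.
apply/eqP => k0; have /eqP := equiv_uv Gphi Ep; rewrite -/(J iv iv) -/k k0.
by rewrite mulr0 eq_sym oner_eq0.
Qed.

Lemma mulmx_jac (X : 'rV[R]_4) j : (X *m 'J phi p) 0 j =
  X 0 iu * J iu j + X 0 ix1 * J ix1 j + X 0 ix2 * J ix2 j + X 0 iv * J iv j.
Proof. by rewrite mulmx_rV4 !(jacE Gphi). Qed.

Let J1u : J ix1 iu = 0. Proof. exact: (jac_u Gphi Up (isT : ix1 != iu)). Qed.
Let J2u : J ix2 iu = 0. Proof. exact: (jac_u Gphi Up (isT : ix2 != iu)). Qed.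
Let Jvu : J iv iu = 0. Proof. exact: (jac_u Gphi Up (isT : iv != iu)). Qed.
Let Jv1 : J iv ix1 = 0. Proof. exact: (jac_vx Gphi false Up). Qed.
Let Jv2 : J iv ix2 = 0. Proof. exact: (jac_vx Gphi true Up). Qed.

Lemma mulmx_jac_v c (e := delta_mx 0 iv : 'rV[R]_4) :
  (c *: e) *m 'J phi p = (c * k) *: e.
Proof.
rewrite /e; apply: rV4P; rewrite mulmx_jac !mxE !eqE /= ?Jvu ?Jv1 ?Jv2 -?/k.
- by move: (J iu _) (J ix1 _) (J ix2 _) => *; ring.
- by move: (J iu _) (J ix1 _) (J ix2 _) => *; ring.
- by move: (J iu _) (J ix1 _) (J ix2 _) => *; ring.
- by move: (J iu _) (J ix1 _) (J ix2 _) k => *; ring.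
Qed.

(** The common shape of nabla_2 and nabla_3, both tangent to the slices u = const. *)
Definition slice_vec (c x y z : R) : 'rV[R]_4 :=
  c *: (x *: delta_mx 0 ix1 - y *: delta_mx 0 ix2 + z *: delta_mx 0 iv).

Lemma slice_vecE c x y z (v := slice_vec c x y z) :
  [/\ v 0 iu = 0, v 0 ix1 = c * x, v 0 ix2 = - (c * y) & v 0 iv = c * z].
Proof. by rewrite /v; split; rewrite !mxE !eqE /=; ring. Qed.

Lemma mulmx_jac_slice c x y z c' x' y' z' :
  c * (x * J ix1 ix1 - y * J ix2 ix1) = c' * x' ->
  c * (x * J ix1 ix2 - y * J ix2 ix2) = - (c' * y') ->
  c * (x * J ix1 iv - y * J ix2 iv + z * k) = c' * z' ->
  slice_vec c x y z *m 'J phi p = slice_vec c' x' y' z'.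
Proof.
have [vu v1 v2 vv] := slice_vecE c x y z.
have [vu' v1' v2' vv'] := slice_vecE c' x' y' z'.
move=> e1 e2 e3.
apply: rV4P; rewrite mulmx_jac vu v1 v2 vv ?vu' ?v1' ?v2' ?vv'.
- by rewrite J1u J2u Jvu; move: (J iu _) => *; ring.
- by rewrite -e1 Jv1; move: (J iu _) (J ix1 _) (J ix2 _) => *; ring.
- by rewrite -e2 Jv2; move: (J iu _) (J ix1 _) (J ix2 _) => *; ring.
- by rewrite -e3 -/k; move: (J iu _) (J ix1 _) (J ix2 _) k => *; ring.
Qed.

(** D_v is pushed forward to k D_v, while the coefficient changes by d^2 / (d^2 k). *)
Lemma nabla1_equiv : den1 t' != 0 ->
  hcoef (nabla1 R) t *m 'J phi p = hcoef (nabla1 R) t'.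
Proof.
move=> d1; have dN0 := equiv_d_neq0; have kN0 := equiv_k_neq0.
apply: (etrans (mulmx_jac_v _)); congr (_ *: _).
rewrite equiv_I1num equiv_den1; move: dN0 kN0 d1.
move: (I1num t') (den1 t') d k => i e x y d0 k0 e0.
by field; rewrite d0 k0 e0.
Qed.

Lemma nabla2_equiv : den2 t' != 0 ->
  hcoef (nabla2 R) t *m 'J phi p = hcoef (nabla2 R) t'.
Proof.
move=> d2; have dN0 := equiv_d_neq0; have kN0 := equiv_k_neq0.
have ec := equiv_curl Gphi Ks Ks' Ep.
rewrite !hcoef_nabla2 -/t -/t'.
have inv x : (den2 t)^-1 * (d * k * x) = (den2 t')^-1 * x.
  rewrite equiv_den2; move: dN0 kN0 d2; move: (den2 t') d k => e x1 y d0 k0 e0.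
  by field; rewrite d0 k0 e0.
have [a1 a2 a3] := nabla2_algebra eZ1 eZ2 ec.
apply: mulmx_jac_slice.
- by rewrite -inv; congr (_ * _); exact: a1.
- by rewrite -[RHS]mulrN -inv; congr (_ * _); exact: a2.
- by rewrite -inv; congr (_ * _); exact: a3.
Qed.

(** The transformation law of T_0 is never computed. The pushed vector Y and the target X' agree in
    their u and x components, and both kill I_1, whose v-derivative is nonzero; so their v
    components agree too. *)
Lemma nabla3_equiv : den1 t' != 0 ->
  hcoef (nabla3 R) t *m 'J phi p = hcoef (nabla3 R) t'.
Proof.
move=> d1; have dN0 := equiv_d_neq0; have kN0 := equiv_k_neq0.
have d1t : den1 t != 0 by rewrite equiv_den1 !mulf_neq0 // expf_neq0.
have dt0 := deth_jet_of_neq0 Ks' 2 N'p.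
have inv x : (deth t)^-1 * (d ^+ 2 * x) = (deth t')^-1 * x.
  rewrite equiv_deth; move: dN0 dt0; rewrite -/t'.
  by move: (deth t') d => e y d0 e0; field; rewrite d0 e0.
pose Y := hcoef (nabla3 R) t *m 'J phi p; pose X' := hcoef (nabla3 R) t'.
have IX := nabla3_I1 Ks Np d1t; have IX' := nabla3_I1 Ks' N'p d1.
have dI' := differentiable_I1fun Ks' N'p.
(* Y kills I_1 of s' because [I1fun s] is [I1fun s' \o phi] near p and nabla_3 kills the former. *)
have IY : \sum_j Y 0 j * partial j (I1fun s') (phi p) = 0.
  rewrite (sum_partial _ dI') /Y; rewrite -IX (sum_partial _ (differentiable_I1fun Ks Np)).
  have -> : hcoef (nabla3 R) t *m 'J phi p = 'd phi p (hcoef (nabla3 R) t).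
    by rewrite mul_rV_lin1.
  set v := hcoef _ _.
  have E := filterS (fun x Ex => equiv_I1fun Gphi Ks Ks' Ex) (equiv_at_near Gphi Ks Ks' Ep).
  transitivity ('D_v (I1fun s) p); last exact: deriveE (differentiable_I1fun Ks Np).
  rewrite (near_eq_derive v (E _)) (deriveE _ (differentiable_comp dphi dI')).
  exact: esym (congr1 (fun g => g v) (diff_comp dphi dI')).
have [xu x1 x2 xv] := slice_vecE (deth t')^-1 (kA t') (kB t') (T0 t' / T1 t').
have [yu y1 y2 yv] := slice_vecE (deth t)^-1 (kA t) (kB t) (T0 t / T1 t).
have Yu : Y 0 iu = X' 0 iu.
  rewrite mulmx_jac xu yu y1 J1u J2u Jvu.
  by move: (J iu _) => *; ring.
have Y1 : Y 0 ix1 = X' 0 ix1.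
  rewrite mulmx_jac x1 yu y1 y2 Jv1 -inv -equiv_kA.
  by move: (J iu _) (J ix1 _) (J ix2 _) => *; ring.
have Y2 : Y 0 ix2 = X' 0 ix2.
  rewrite mulmx_jac x2 yu y1 y2 Jv2 -inv -[d ^+ 2 * _]opprK -equiv_kB.
  by move: (J iu _) (J ix1 _) (J ix2 _) => *; ring.
apply: rV4P => //.
have := partial_v_I1fun Ks' N'p; rewrite -/t'.
have := etrans IY (esym IX'); rewrite !sum_I4 Yu Y1 Y2 -/X'.
move: (partial iv _ _) => dv; move/addrI => E E2.
have dv0 : dv != 0.
  apply/eqP => dv0; move/eqP: E2; rewrite dv0 mul0r eq_sym.
  by rewrite !mulf_eq0 pnatr_eq0 (negPf dt0) (negPf d1).
exact: (mulIf dv0 E).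
Qed.

Lemma kundt_metric_jac : kundt_metric (s p)
  = 'J phi p *m kundt_metric (s' (phi p)) *m ('J phi p)^T.
Proof. by case: Ep => _ _ _ /nbhs_singleton. Qed.

(** Gradients are natural under isometries: dI_1 pulls back by J^T and G = J G' J^T, so both sides
    become equal after multiplication by G' and then by J^T. *)
Lemma nabla4_equiv : hcoef (nabla4 R) t *m 'J phi p = hcoef (nabla4 R) t'.
Proof.
have [_ _ hp _] := Ks; have [_ _ hp' _] := Ks'.
have uG := kundt_metric_unit (hp _ Np); have uG' := kundt_metric_unit (hp' _ N'p).
have uJ : 'J phi p \in unitmx.
  by move: uG; rewrite kundt_metric_jac !unitmx_mul => /andP[/andP[]].
rewrite /= /sharp /t /t' !jfib_jet_of (hdiff_I1_jet_of Ks Np) (hdiff_I1_jet_of Ks' N'p).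
set o := \row_i _; set o' := \row_i _.
have oE : o = o' *m ('J phi p)^T.
  apply/rowP => i; rewrite !mxE.
  have E := filterS (fun x Ex => equiv_I1fun Gphi Ks Ks' Ex) (equiv_at_near Gphi Ks Ks' Ep).
  rewrite (near_eq_partial i (E _)).
  rewrite (partial_comp i dphi (differentiable_I1fun Ks' N'p)).
  by apply: eq_bigr => j _; rewrite !mxE mulrC.
apply: (can_inj (mulmxK uG')); rewrite mulmxKV //.
have uJT : ('J phi p)^T \in unitmx by rewrite unitmx_tr.
apply: (can_inj (mulmxK uJT)); rewrite -oE -(mulmxA _ ('J phi p)) -mulmxA.
by rewrite -kundt_metric_jac mulmxKV.
Qed.
End Equivariance.

(** * Invariance and independence *)

Section Invariance.
Variable R : realType.

Lemma nabla1_invariant : invariant_derivation (nabla1 R).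
Proof.
apply: invariant_derivation_jets => U phi N N' s s' p G Up Np N'p Ks Ks' iso.
have Ep : equiv_at U phi N N' s s' p by split.
case=> _ d1; have d1' : den1 (jet_of 2 s' (phi p)) != 0.
  by move: d1; rewrite (equiv_den1 G Ks Ks' Ep); apply: contraNneq => ->; rewrite mulr0.
split; last exact: (nabla1_equiv G Ks Ks' Ep d1').
by split; [exact: kundt_jet_of Ks' 2 _ N'p | exact: d1'].
Qed.

Lemma nabla2_invariant : invariant_derivation (nabla2 R).
Proof.
apply: invariant_derivation_jets => U phi N N' s s' p G Up Np N'p Ks Ks' iso.
have Ep : equiv_at U phi N N' s s' p by split.
case=> _ d2; have d2' : den2 (jet_of 2 s' (phi p)) != 0.
  by move: d2; rewrite (equiv_den2 G Ks Ks' Ep); apply: contraNneq => ->; rewrite mulr0.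
split; last exact: (nabla2_equiv G Ks Ks' Ep d2').
by split; [exact: kundt_jet_of Ks' 2 _ N'p | exact: d2'].
Qed.

Lemma nabla3_invariant : invariant_derivation (nabla3 R).
Proof.
apply: invariant_derivation_jets => U phi N N' s s' p G Up Np N'p Ks Ks' iso.
have Ep : equiv_at U phi N N' s s' p by split.
case=> _; rewrite /T1 mulf_eq0 negb_or => /andP[_ d1].
have d1' : den1 (jet_of 2 s' (phi p)) != 0.
  by move: d1; rewrite (equiv_den1 G Ks Ks' Ep); apply: contraNneq => ->; rewrite mulr0.
split; last exact: (nabla3_equiv G Ks Ks' Ep d1').
split; first exact: kundt_jet_of Ks' 2 _ N'p.
by rewrite /= /T1 !mulf_neq0 ?pnatr_eq0 ?(deth_jet_of_neq0 Ks' 2 N'p).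
Qed.

Lemma nabla4_invariant : invariant_derivation (nabla4 R).
Proof.
apply: invariant_derivation_jets => U phi N N' s s' p G Up Np N'p Ks Ks' iso _.
have Ep : equiv_at U phi N N' s s' p by split.
split; first exact: kundt_jet_of Ks' 2 _ N'p.
exact: (nabla4_equiv G Ks Ks' Ep).
Qed.
End Invariance.

(** * Independence on the open set den1 den2 != 0 *)

Section Independence.
Variable R : realType.

Lemma jcoord_mi_at k (t : jet R k) a (j : 'I_#|mi k|) :
  jcoord t a (fun i => val (mi_at j) i) = t.2 a j.
Proof.
have [j' jj' ->] := jcoord_index R (mi_at_sum j); congr (t.2 a _).
apply: enum_val_inj; apply: val_inj; apply/ffunP => i; apply: val_inj.
exact: (congr1 (fun f => f i) jj').
Qed.

Lemma jet_polynomial_jd k a w : jet_polynomial (fun t : jet R k => jd t a w).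
Proof.
case: (jd_coordinate R k a w) => [[j E]|Z].
  by rewrite (funext E); exact: JPcoord.
by rewrite (funext Z); exact: JPconst.
Qed.

Lemma jet_polynomial_sub k (P Q : jet R k -> R) :
  jet_polynomial P -> jet_polynomial Q -> jet_polynomial (fun t => P t - Q t).
Proof.
move=> pP pQ.
rewrite (_ : (fun t => _) = (fun t => P t + -1 * Q t)).
  by apply: JPadd => //; apply: JPmul => //; exact: JPconst.
by apply/funext => t; rewrite mulN1r.
Qed.

Lemma jet_polynomial_dens : jet_polynomial (fun t => den1 t * den2 t : R).
Proof.
have P a w := @jet_polynomial_jd 2 a w.
apply: JPmul.
  by apply: jet_polynomial_sub; apply: JPmul => //;
    apply: jet_polynomial_sub; apply: JPmul.
by apply: jet_polynomial_sub; apply: JPmul.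
Qed.

(** Jet coordinates are linear, so the derivative along T is the value at T. *)
Lemma is_derive_jd k (t T : jet R k) a w : is_derive t T (fun t => jd t a w) (jd T a w).
Proof.
have dj := differentiable_jd t a w.
split; first exact: diff_derivable.
apply: cvg_lim => //.
have -> : (fun h : R => h^-1 *: (((fun t => jd t a w) \o shift t) (h *: T) - jd t a w))
  = (fun h : R => h^-1 * h * jd T a w).
  apply/funext => h; rewrite /= -mulrA; congr (_ * _).
  case: (jd_coordinate R k a w) => [[j E]|Z]; last by rewrite !Z subrr mulr0.
  by rewrite !E /= !mxE addrK.
apply: cvg_near_cst; near=> h.
by rewrite mulVf ?mul1r //; near: h; exact: nbhs_dnbhs_neq.
Unshelve. all: by end_near. Qed.

Lemma jd_jproj1 (t : jet R 2) a w : (size w <= 1)%N -> jd (jproj 1 t) a w = jd t a w.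
Proof.
move=> w1; rewrite /jd /jproj.
by rewrite (jcoord_mx _ (fun a m => jcoord t a m)) ?sum_count_mem.
Qed.

Lemma jd_total_vector (t : jet R 2) i a w : (size w <= 1)%N ->
  jd (total_vector t i : jet R 1) a w = jd t a (i :: w).
Proof.
move=> w1; rewrite /jd /total_vector.
rewrite (jcoord_mx _ (fun a m => jcoord t a (fun l => m l + (l == i))%N))
  ?sum_count_mem //.
by congr (jcoord t a _); apply/funext => l; rewrite /= addnC eq_sym.
Qed.

Lemma deth_gt0 k (t : jet R k) : kundt_jet t -> 0 < deth t.
Proof. by case=> /h_posdef_gt0[_ _]; rewrite !mxE. Qed.

Lemma kundt_jet_hv (t : jet R 2) a : kundt_jet t -> is_h a -> jd t a [:: iv] = 0.
Proof.
case=> _ tv ha; have c1 : (\sum_i count_mem i [:: iv] <= 2)%N by rewrite sum_count_mem.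
have [j jv E] := jcoord_index R c1; rewrite /jd E -[j]enum_valK; apply: tv => //.
by rewrite -[enum_val j]/(mi_at j) (congr1 (fun f => f iv) jv).
Qed.

(** The counterpart of [partial_v_I1fun] for an arbitrary point of E^2, which is not given as the
    jet of a section; the computation is therefore done on the jet space itself. *)
Lemma total_deriv_v_I1 (t : jet R 2) : kundt_jet t ->
  total_deriv iv (@I1 R) t * deth t = 2 * den1 t.
Proof.
move=> Kt; have dt : deth t != 0 by rewrite gt_eqF // deth_gt0.
pose t1 := jproj 1 t; pose T := total_vector t iv : jet R 1.
have t1d : deth t1 = deth t by rewrite /deth !jd_jproj1.
have d1 : deth t1 != 0 by rewrite t1d.
have DI : is_derive t1 T (@I1 R) (total_deriv iv (@I1 R) t).
  by apply: derivableP; apply: diff_derivable; exact: differentiable_I1.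
have D a w := is_derive_jd t1 T a w.
have Dd := is_derive_sub (is_derive_mul (D ch11 [::]) (D ch22 [::]))
  (is_derive_sqr (D ch12 [::])).
have Dn := is_derive_add (is_derive_sub
    (is_derive_mul (is_derive_sqr (D cW1 [:: iv])) (D ch22 [::]))
    (is_derive_mul (is_derive_mul (is_derive_mul (is_derive_const _ _ 2)
       (D cW1 [:: iv])) (D cW2 [:: iv])) (D ch12 [::])))
  (is_derive_mul (is_derive_sqr (D cW2 [:: iv])) (D ch11 [::])).
have E : \forall x \near t1, I1 x * deth x = I1num x.
  have cd : {for t1, continuous (@deth R 1)}.
    by apply: differentiable_continuous; exact: differentiable_deth.
  have nd : \forall x \near t1, deth x != 0.
    exact: (cd [set y | y != 0] (open_nbhs_nbhs (conj (@open_neq R 0) d1))).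
  have E (x : jet R 1) : deth x != 0 -> I1 x * deth x = I1num x.
    by move=> dx; rewrite /I1 divfK.
  exact: filterS E nd.
have [_ E1] := near_eq_is_derive E (is_derive_mul DI Dd).
have [_ E2] := Dn.
have E0 : I1 t1 * deth t1 = I1num t1 by rewrite /I1 divfK.
have := etrans (esym E1) E2; move: E0 dt.
rewrite -/(deth t1) t1d /I1num /den1 /kA /kB /deth /T.
rewrite !jd_jproj1 // !jd_total_vector // (@kundt_jet_hv _ ch11 Kt isT)
  (@kundt_jet_hv _ ch12 Kt isT) (@kundt_jet_hv _ ch22 Kt isT).
move: (total_deriv _ _ _) (I1 _) => dI I.
move: (jd t cW1 [:: iv]) (jd t cW2 [:: iv]) (jd t cW1 [:: iv; iv]) (jd t cW2 [:: iv; iv]).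
move: (jd t ch11 _) (jd t ch12 _) (jd t ch22 _).
clear => a b c w1 w2 z1 z2 E0 d0 E.
have -> : dI * (a * c - b ^+ 2) = I * (a * 0 + c * 0 - 2 * b * 0)
  + (a * c - b ^+ 2) * dI by ring.
by rewrite E; ring.
Qed.

(** The v column of the Gram matrix has 1/2 in its u entry and 0 elsewhere, so the v entry of X G =
    dI_1 reads X_u / 2 = (I_1)_v. *)
Lemma nabla4_u (t : jet R 2) : kundt_jet t ->
  hcoef (nabla4 R) t 0 iu * deth t = 4 * den1 t.
Proof.
move=> Kt; have uG : kundt_metric (jfib t) \in unitmx.
  by apply: kundt_metric_unit; case: Kt.
pose X := hcoef (nabla4 R) t.
have XG : X *m kundt_metric (jfib t) = hdiff (@I1 R) t by rewrite /X /= mulmxKV.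
have := congr1 (fun M : 'rV[R]_4 => M 0 iv) XG.
rewrite mulmx_rV4 !kundt_metricE !eqE /= [RHS]mxE => E.
have := total_deriv_v_I1 Kt; rewrite -E -/X.
by move: (X 0 iu) (deth t) (den1 t) => x d e; lra.
Qed.

(** Completing the square: h_22 [I1num] = A^2 + det h (W_2)_v^2 and h_11 [I1num] = B^2 + det h
    (W_1)_v^2, with det h > 0. *)
Lemma I1num_eq0 k (t : jet R k) : kundt_jet t -> I1num t = 0 ->
  kA t = 0 /\ kB t = 0.
Proof.
case=> /h_posdef_gt0[]; rewrite !mxE /kA /kB /I1num => _ _ d0 _ i0.
move: d0 i0; move: (jd t cW1 _) (jd t cW2 _) (jd t ch11 _) (jd t ch12 _) (jd t ch22 _).
move=> w1 w2 a b c d0 i0.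
have sq0 (x y : R) : x ^+ 2 + (a * c - b ^+ 2) * y ^+ 2 = 0 -> x = 0.
  move=> e; apply/eqP; rewrite -sqrf_eq0 eq_le sqr_ge0 andbT -e lerDl.
  by rewrite mulr_ge0 ?sqr_ge0 // ltW.
split; [apply: (sq0 _ w2) | apply: (sq0 _ w1)].
  transitivity (c * (w1 ^+ 2 * c - 2 * w1 * w2 * b + w2 ^+ 2 * a)); first by ring.
  by rewrite i0 mulr0.
transitivity (a * (w1 ^+ 2 * c - 2 * w1 * w2 * b + w2 ^+ 2 * a)); first by ring.
by rewrite i0 mulr0.
Qed.

(** The equations are the v, x^2, x^1 and u components of a vanishing combination. Elimination runs
    from the last to the first: u gives v3 = 0, the x pair has determinant A p - B q up to nonzero
    factors, and v gives v0 = 0. *)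
Lemma independence_algebra (v0 v1 v2 v3 g gv g1 g2 A B p q x z d2 d i : R) :
  g != 0 -> A * p - B * q != 0 -> d2 != 0 -> d != 0 -> i != 0 ->
  v0 * (i / (A * p - B * q)) + v1 * (d2^-1 * x) + v2 * (d^-1 * z) + v3 * gv = 0 ->
  v0 * 0 + v1 * - (d2^-1 * p) + v2 * - (d^-1 * B) + v3 * g2 = 0 ->
  v0 * 0 + v1 * (d2^-1 * q) + v2 * (d^-1 * A) + v3 * g1 = 0 ->
  v0 * 0 + v1 * 0 + v2 * 0 + v3 * g = 0 ->
  [/\ v0 = 0, v1 = 0, v2 = 0 & v3 = 0].
Proof.
move=> g0 e0 d20 d0 i0 e1 e2 e3; rewrite !mulr0 !add0r => /eqP.
rewrite mulf_eq0 (negPf g0) orbF => /eqP v30; move: e1 e2 e3.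
rewrite v30 !mul0r mulr0 !addr0 add0r => e1 e2 e3.
have e2' : v1 / d2 * p + v2 / d * B = 0 by rewrite -[RHS]oppr0 -e2; ring.
have e3' : v1 / d2 * q + v2 / d * A = 0 by rewrite -e3; ring.
have v10 : v1 = 0.
  apply: (mulIf (invr_neq0 d20)); apply: (mulIf e0); rewrite !mul0r.
  transitivity (A * (v1 / d2 * p + v2 / d * B) - B * (v1 / d2 * q + v2 / d * A)).
    by ring.
  by rewrite e2' e3' !mulr0 subrr.
have v20 : v2 = 0.
  apply: (mulIf (invr_neq0 d0)); apply: (mulIf e0); rewrite !mul0r.
  transitivity (p * (v1 / d2 * q + v2 / d * A) - q * (v1 / d2 * p + v2 / d * B)).
    by ring.
  by rewrite e2' e3' !mulr0 subrr.
split=> //; move/eqP: e1; rewrite v10 v20 !mul0r !addr0.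
by rewrite !mulf_eq0 invr_eq0 (negPf i0) (negPf e0) !orbF => /eqP.
Qed.

Lemma nabla_independent :
  independent_on (nabla R) [set t | kundt_jet t /\ den1 t * den2 t != 0].
Proof.
move=> t [Kt]; rewrite mulf_eq0 negb_or => /andP[d1 d2].
have d0 : deth t != 0 by rewrite gt_eqF // deth_gt0.
(* The coefficient of nabla_1 does not vanish: if |w|^2 were 0, then A = B = 0 and [den1] would be
   0. *)
have n0 : I1num t != 0.
  apply: contraNneq d1 => /(I1num_eq0 Kt)[A0 B0].
  by rewrite /den1 A0 B0 !mul0r subrr.
have T10 : T1 t != 0 by rewrite /T1 !mulf_neq0 // pnatr_eq0.
split; first by apply: I4P.
apply: inj_row_free => v /rowP vM.
have nablaE j : v 0 iu * hcoef (nabla1 R) t 0 j + v 0 ix1 * hcoef (nabla2 R) t 0 j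
    + v 0 ix2 * hcoef (nabla3 R) t 0 j + v 0 iv * hcoef (nabla4 R) t 0 j = 0.
  have rowE i : (\matrix_(i < 4) hcoef (nabla R i) t) i j = hcoef (nabla R i) t 0 j.
    by rewrite mxE.
  by have := vM j; rewrite mulmx_rV4 !rowE [RHS]mxE; exact.
have [xu x1 x2 xv] := slice_vecE (den2 t)^-1 (jd t cW2 [:: iv; iv])
  (jd t cW1 [:: iv; iv]) (jd t cW1 [:: ix2; iv] - jd t cW2 [:: ix1; iv]).
have [yu y1 y2 yv] := slice_vecE (deth t)^-1 (kA t) (kB t) (T0 t / T1 t).
have [zu z1 z2 zv] : [/\ hcoef (nabla1 R) t 0 iu = 0, hcoef (nabla1 R) t 0 ix1 = 0,
    hcoef (nabla1 R) t 0 ix2 = 0 & hcoef (nabla1 R) t 0 iv = I1num t / den1 t].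
  by split; rewrite !mxE !eqE /= ?mulr0 ?mulr1.
have uN0 : hcoef (nabla4 R) t 0 iu != 0.
  apply: contraNneq d1 => u0; have := nabla4_u Kt.
  by rewrite u0 mul0r => /esym/eqP; rewrite mulf_eq0 pnatr_eq0.
have := nablaE iu; have := nablaE ix1; have := nablaE ix2; have := nablaE iv.
rewrite xu x1 x2 xv yu y1 y2 yv zu z1 z2 zv.
move: uN0 d1 d2 d0 n0; rewrite /den1 => g0 d1 d2 d0 n0 e1 e2 e3 e4.
have [v0 v1 v2 v3] := independence_algebra g0 d1 d2 d0 n0 e1 e2 e3 e4.
by apply: rV4P; rewrite [RHS]mxE.
Qed.

Lemma exists_generic_jet (t0 : jet R 0) : kundt_jet t0 ->
  exists t : jet R 2, [/\ kundt_jet t, jproj 0 t = t0 & den1 t * den2 t != 0].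
Proof.
move=> [hp _]; have [_ h220 _] := h_posdef_gt0 hp.
(* [c] is the solution of h_22 c - h_12 = 1. *)
pose y := jfib t0; pose c := (1 + y 0 ch12) / y 0 ch22.
(* (W_1)_v = 1, (W_2)_v = 0, (W_1)_vv = c and (W_2)_vv = 1 give
   den1 = den2 = 1. *)
pose F (a : 'I_6) (m : 'I_4 -> nat) : R :=
  if [|| m iu != 0, m ix1 != 0 | m ix2 != 0]%N then 0 else
  match m iv with
  | 0%N => y 0 a
  | 1%N => (a == cW1)%:R
  | 2%N => c * (a == cW1)%:R + (a == cW2)%:R
  | _ => 0
  end.
pose t : jet R 2 := (t0.1, \matrix_(a, j) F a (fun l => val (mi_at j) l)).
have tF a w : (size w <= 2)%N -> jd t a w = F a (fun i => count_mem i w).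
  by move=> w2; rewrite /jd /t jcoord_mx // sum_count_mem.
have yE : jfib t = y by apply/rowP => a; rewrite mxE tF.
exists t; split.
- split; first by rewrite yE.
  move=> a m ha m0; rewrite /t mxE /mi_at enum_rankK /F; case: ifP => // _.
  move: ha m0; rewrite /is_h !inE => /or3P[] /eqP ->;
    case: (val m iv : nat) => [|[|[|n]]] //= _.
  all: rewrite ?eqE /= ?mulr0 ?addr0 //.
- have m0 (j : 'I_#|mi 0|) : (fun i => val (mi_at j) i : nat) = (fun=> 0%N).
    by apply/funext => i; rewrite ord1.
  rewrite /jproj [RHS]surjective_pairing; congr (_, _); apply/matrixP => a j.
  rewrite mxE -jcoord_mi_at m0 /t jcoord_mx ?big1 // /F /= /y mxE.
  by rewrite /jd; congr jcoord.
suff -> : den1 t * den2 t = 1 by exact: oner_neq0.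
rewrite /den1 /den2 /kA /kB !tF // /F /= /c.
by field; rewrite gt_eqF.
Qed.

Lemma nabla_domain_zariski_open :
  zariski_open_in_fibers [set t : jet R 2 | kundt_jet t /\ den1 t * den2 t != 0].
Proof.
split=> [t []|t0 Kt0]; first by [].
split.
  have [t [Kt tt0 dt]] := exists_generic_jet Kt0.
  by exists t; split.
exists [set fun t => den1 t * den2 t]; split.
  by move=> _ ->; exact: jet_polynomial_dens.
apply/seteqP; split => [t [[Kt dt] [_ tt0]]|t [[Kt tt0] [_ -> dt]]].
  by split=> //; exists (fun t => den1 t * den2 t).
by split.
Qed.
End Independence.

Theorem proposition16 (R : realType) :
  (forall i : 'I_4, invariant_derivation (nabla R i)) /\
  (exists O : set (jet R 2),
     zariski_open_in_fibers O /\ independent_on (nabla R) O).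
Proof.
split.
  apply: I4P; [exact: nabla1_invariant | exact: nabla2_invariant
    | exact: nabla3_invariant | exact: nabla4_invariant].
exists [set t | kundt_jet t /\ den1 t * den2 t != 0].
by split; [exact: nabla_domain_zariski_open | exact: nabla_independent].
Qed.
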